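(* Let $k$ be an algebraically closed field and let $A$ and $B$ be two noetherian local $k$-algebras such that the completed tensor product $A\hat{\otimes}_{k}B$ is noetherian. Then $A\hat{\otimes}_{k}B$ is a domain if and only if $A$ and $B$ are analytically irreducible.
   Context: All rings are commutative with identity. A noetherian local ring is given the topology defined by the powers of its maximal ideal. If $\mathfrak{m},\mathfrak{n}$ are the maximal ideals of $A,B$, then $A\hat{\otimes}_k B$ is the (separated) completion of $A\otimes_k B$ for the topology defined by the powers of the ideal $\mathfrak{m}(A\otimes_k B)+\mathfrak{n}(A\otimes_k B)$. A noetherian local ring is analytically irreducible if its completion is a domain. *)

(* Defs.v *)
From HB Require Import structures.
From mathcomp Require Import all_boot all_order all_algebra.
From mathcomp Require Import boolp classical_sets functions.

Set Implicit Arguments.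
Unset Strict Implicit.
Unset Printing Implicit Defensive.

Import GRing.Theory.

Local Open Scope classical_set_scope.
Local Open Scope quotient_scope.
Local Open Scope ring_scope.

(* Rings are [comPzRingType]s throughout: a completion, or a tensor product,
   may a priori be the zero ring. *)

Section Ideals.
Variable R : comPzRingType.
Implicit Types (I J m : set R) (S : set R).

Definition is_ideal I :=
  [/\ I 0, forall x y, I x -> I y -> I (x + y) & forall a x, I x -> I (a * x)].

Definition ideal_gen S : set R := smallest is_ideal S.

Definition ideal_add I J : set R := [set x + y | x in I & y in J].

Definition ideal_mul I J : set R := ideal_gen [set x * y | x in I & y in J].

Fixpoint ideal_exp I n : set R :=
  if n is n'.+1 then ideal_mul I (ideal_exp I n') else setT.

Definition maximal_ideal m :=
  [/\ is_ideal m, ~ m 1 &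
      forall J, is_ideal J -> m `<=` J -> J = m \/ J = setT].

Definition local_ring m :=
  maximal_ideal m /\ forall m', maximal_ideal m' -> m' = m.

Lemma ideal_gen_ideal S : is_ideal (ideal_gen S).
Proof.
split=> [J [[J0 _ _] _] //|x y xS yS J JS|a x xS J JS].
  by have [[_ JD _] _] := JS; apply: JD; [exact: xS|exact: yS].
by have [[_ _ JM] _] := JS; apply: JM; exact: xS.
Qed.

Lemma ideal_exp_ideal I n : is_ideal (ideal_exp I n).
Proof. by case: n => [|n]; [split|apply: ideal_gen_ideal]. Qed.

Lemma is_idealN I x : is_ideal I -> I x -> I (- x).
Proof. by case=> _ _ IM Ix; rewrite -mulN1r; apply: IM. Qed.

Lemma is_idealB I x y : is_ideal I -> I x -> I y -> I (x - y).
Proof.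
by move=> II Ix Iy; case: (II) => _ ID _; apply: ID => //; exact: is_idealN.
Qed.

End Ideals.

Definition noetherian (R : comPzRingType) :=
  forall I : set R, is_ideal I -> exists s : seq R, I = ideal_gen [set` s].

Definition is_domain (R : comPzRingType) :=
  (1 : R) != 0 /\ GRing.integral_domain_axiom R.

(* The separated completion of R for the I-adic topology: Cauchy sequences
   modulo null sequences.  The powers of I form a countable basis of
   neighbourhoods of 0, so sequences suffice. *)
Section Completion.
Variables (R : comPzRingType) (I : set R).
Implicit Types u v : nat -> R.

Definition adic_cauchy u := forall n, exists N, forall i j,
  (N <= i)%N -> (N <= j)%N -> ideal_exp I n (u i - u j).

Definition adic_null u := forall n, exists N, forall i,
  (N <= i)%N -> ideal_exp I n (u i).

Definition cauchy_pred : {pred (nat -> R)} := fun u => `[< adic_cauchy u >].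

Fact cauchy_subring_closed : subring_closed cauchy_pred.
Proof.
split=> [|u v /asboolP uC /asboolP vC|u v /asboolP uC /asboolP vC];
  apply/asboolP => n.
- by exists 0 => i j _ _; rewrite subrr; case: (ideal_exp_ideal I n).
- have [N uN] := uC n; have [M vM] := vC n; exists (maxn N M) => i j.
  rewrite !geq_max => /andP[Ni Mi] /andP[Nj Mj].
  rewrite [X in ideal_exp _ _ X](_ : _ = (u i - u j) - (v i - v j)).
    by apply: is_idealB; [exact: ideal_exp_ideal|exact: uN|exact: vM].
  by rewrite !addrfctE !opprfctE !opprD !opprK addrACA.
- have [N uN] := uC n; have [M vM] := vC n; exists (maxn N M) => i j.
  rewrite !geq_max => /andP[Ni Mi] /andP[Nj Mj].
  rewrite [X in ideal_exp _ _ X]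
    (_ : _ = v i * (u i - u j) + u j * (v i - v j)).
    have [_ ID IM] := ideal_exp_ideal I n.
    by apply: ID; apply: IM; [exact: uN|exact: vM].
  rewrite !mulrfctE !mulrBr [v i * u i]mulrC [v i * u j]mulrC.
  by rewrite addrA subrK.
Qed.

HB.instance Definition _ :=
  GRing.isSubringClosed.Build (nat -> R) cauchy_pred cauchy_subring_closed.

Record cauchy : Type :=
  Cauchy { cauchy_val :> nat -> R; _ : cauchy_val \in cauchy_pred }.

HB.instance Definition _ := [isSub for cauchy_val].
HB.instance Definition _ := [Choice of cauchy by <:].
HB.instance Definition _ := GRing.SubChoice_isSubComPzRing.Build
  (nat -> R) cauchy_pred cauchy cauchy_subring_closed.

Definition null_pred : {pred cauchy} := fun u : cauchy => `[< adic_null u >].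

Fact null_zmod_closed : zmod_closed null_pred.
Proof.
split=> [|u v /asboolP u0 /asboolP v0]; apply/asboolP => n.
  by exists 0 => i _; case: (ideal_exp_ideal I n).
have [N uN] := u0 n; have [M vM] := v0 n; exists (maxn N M) => i.
rewrite geq_max => /andP[Ni Mi].
by apply: is_idealB; [exact: ideal_exp_ideal|exact: uN|exact: vM].
Qed.

HB.instance Definition _ :=
  GRing.isZmodClosed.Build cauchy null_pred null_zmod_closed.

Fact null_mull (u v : cauchy) : v \in null_pred -> u * v \in null_pred.
Proof.
move=> /asboolP v0; apply/asboolP => n; have [N vN] := v0 n.
by exists N => i Ni; have [_ _ IM] := ideal_exp_ideal I n; apply/IM/vN.
Qed.

Definition completion : Type := Quotient.quot null_pred.

HB.instance Definition _ := Quotient.on completion.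
HB.instance Definition _ := GRing.Zmodule.on completion.

Definition compl_pi (u : cauchy) : completion := \pi u.
Definition compl_repr (x : completion) : cauchy := repr x.

Definition compl_one : completion := compl_pi 1.
Definition compl_mul (x y : completion) : completion :=
  compl_pi (compl_repr x * compl_repr y).

Lemma compl_reprK : cancel compl_repr compl_pi.
Proof. by move=> x; exact: reprK. Qed.

Lemma compl_eqP (u v : cauchy) :
  reflect (compl_pi u = compl_pi v) (u - v \in null_pred).
Proof. by rewrite Quotient.idealrBE; apply: eqP. Qed.

Lemma compl_piD (u v : cauchy) :
  compl_pi (u + v) = compl_pi u + compl_pi v.
Proof. exact: (Quotient.pi_add null_pred u v). Qed.

Lemma compl_piM (u v : cauchy) :
  compl_pi (u * v) = compl_mul (compl_pi u) (compl_pi v).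
Proof.
apply/compl_eqP; set u' := compl_repr _; set v' := compl_repr _.
have uu' : u - u' \in null_pred by apply/compl_eqP; rewrite compl_reprK.
have vv' : v - v' \in null_pred by apply/compl_eqP; rewrite compl_reprK.
rewrite (_ : _ - _ = v * (u - u') + u' * (v - v')); last first.
  by rewrite !mulrBr [v * u]mulrC [v * u']mulrC addrA subrK.
by rewrite rpredD ?null_mull.
Qed.

Fact compl_mulA : associative compl_mul.
Proof.
move=> x y z; rewrite -[x]compl_reprK -[y]compl_reprK -[z]compl_reprK.
by rewrite -!compl_piM mulrA.
Qed.

Fact compl_mulC : commutative compl_mul.
Proof. by move=> x y; rewrite /compl_mul mulrC. Qed.

Fact compl_mul1 : left_id compl_one compl_mul.
Proof. by move=> x; rewrite -[x]compl_reprK -compl_piM mul1r. Qed.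

Fact compl_mulDl : left_distributive compl_mul +%R.
Proof.
move=> x y z; rewrite -[x]compl_reprK -[y]compl_reprK -[z]compl_reprK.
by rewrite -compl_piD -!compl_piM mulrDl compl_piD.
Qed.

HB.instance Definition _ := GRing.Zmodule_isComPzRing.Build completion
  compl_mulA compl_mulC compl_mul1 compl_mulDl.

End Completion.

Definition analytically_irreducible (R : comPzRingType) (m : set R) :=
  is_domain (completion m).

(* The ring A (x)_k B: formal finite sums of pairs (a, b), represented as
   lists, modulo the congruence generated by the bilinearity relations. *)
Section Tensor.
Variables (k : comNzRingType) (A B : comAlgType k).
Implicit Types s t u : seq (A * B).

Inductive tensor_rel : seq (A * B) -> seq (A * B) -> Prop :=
| tensor_perm s t : perm_eq s t -> tensor_rel s t
| tensor_sym s t : tensor_rel s t -> tensor_rel t s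
| tensor_trans s t u : tensor_rel s t -> tensor_rel t u -> tensor_rel s u
| tensor_cat s s' t t' :
    tensor_rel s s' -> tensor_rel t t' -> tensor_rel (s ++ t) (s' ++ t')
| tensor_rel0 b : tensor_rel [:: (0, b)] [::]
| tensor_relDl a a' b : tensor_rel [:: (a + a', b)] [:: (a, b); (a', b)]
| tensor_relDr a b b' : tensor_rel [:: (a, b + b')] [:: (a, b); (a, b')]
| tensor_relZ c a b : tensor_rel [:: (c *: a, b)] [:: (a, c *: b)].

Definition tensor_mul_seq s t : seq (A * B) :=
  [seq (x.1 * y.1, x.2 * y.2) | x <- s, y <- t].

Definition tensor_opp_seq s : seq (A * B) := [seq (- x.1, x.2) | x <- s].

Lemma tensor_refl s : tensor_rel s s.
Proof. exact: tensor_perm. Qed.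

Fact tensor_equiv_class : equiv_class_of (fun s t => `[< tensor_rel s t >]).
Proof.
split=> [s|s t|t s u].
- exact/asboolP/tensor_refl.
- by apply/asboolP/asboolP; exact: tensor_sym.
- by move=> /asboolP st /asboolP tu; apply/asboolP; exact: tensor_trans st tu.
Qed.
Canonical tensor_equiv := EquivRelPack tensor_equiv_class.

Definition tensor : Type := {eq_quot tensor_equiv}.

HB.instance Definition _ := Choice.on tensor.
HB.instance Definition _ := Quotient.on tensor.

Definition tensor_pi s : tensor := \pi s.
Definition tensor_repr (x : tensor) : seq (A * B) := repr x.

Lemma tensor_reprK : cancel tensor_repr tensor_pi.
Proof. by move=> x; exact: reprK. Qed.

Lemma tensor_eqP s t : (tensor_pi s = tensor_pi t) <-> tensor_rel s t.
Proof. by split=> [/eqmodP/asboolP|st]; last exact/eqmodP/asboolP. Qed.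

Lemma tensor_repr_pi s : tensor_rel (tensor_repr (tensor_pi s)) s.
Proof. by apply/tensor_eqP; rewrite tensor_reprK. Qed.

Definition tensor_zero : tensor := tensor_pi [::].
Definition tensor_one : tensor := tensor_pi [:: (1, 1)].
Definition tensor_opp (x : tensor) : tensor :=
  tensor_pi (tensor_opp_seq (tensor_repr x)).
Definition tensor_add (x y : tensor) : tensor :=
  tensor_pi (tensor_repr x ++ tensor_repr y).
Definition tensor_mul (x y : tensor) : tensor :=
  tensor_pi (tensor_mul_seq (tensor_repr x) (tensor_repr y)).

Lemma tensor_mul_seq_relDl a a' b t :
  tensor_rel (tensor_mul_seq [:: (a + a', b)] t)
             (tensor_mul_seq [:: (a, b); (a', b)] t).
Proof.
rewrite /tensor_mul_seq /= !cats0.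
elim: t => [|y t IHt] /=; first exact: tensor_refl.
rewrite mulrDl; apply: tensor_trans (tensor_cat (tensor_relDl _ _ _) IHt) _.
by apply: tensor_perm; rewrite /= perm_cons -cat1s perm_catCA.
Qed.

Lemma tensor_mul_seq_relDr a b b' t :
  tensor_rel (tensor_mul_seq [:: (a, b + b')] t)
             (tensor_mul_seq [:: (a, b); (a, b')] t).
Proof.
rewrite /tensor_mul_seq /= !cats0.
elim: t => [|y t IHt] /=; first exact: tensor_refl.
rewrite mulrDl; apply: tensor_trans (tensor_cat (tensor_relDr _ _ _) IHt) _.
by apply: tensor_perm; rewrite /= perm_cons -cat1s perm_catCA.
Qed.

Lemma tensor_mul_seqr s s' t :
  tensor_rel s s' -> tensor_rel (tensor_mul_seq s t) (tensor_mul_seq s' t).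
Proof.
elim=> {s s'}.
- by move=> s s' ss'; apply: tensor_perm; apply: perm_allpairs.
- by move=> s s' _; exact: tensor_sym.
- by move=> s s' s'' _ IH1 _ IH2; exact: tensor_trans IH1 IH2.
- move=> s s' u u' _ IH1 _ IH2; rewrite /tensor_mul_seq !allpairs_cat.
  exact: tensor_cat.
- move=> b; rewrite /tensor_mul_seq /= cats0; elim: t => [|y t IHt] /=.
    exact: tensor_refl.
  by rewrite mul0r; exact: (tensor_cat (tensor_rel0 _) IHt).
- by move=> a a' b; exact: tensor_mul_seq_relDl.
- by move=> a b b'; exact: tensor_mul_seq_relDr.
- move=> c a b; rewrite /tensor_mul_seq /= !cats0.
  elim: t => [|y t IHt] /=; first exact: tensor_refl.
  by rewrite -!scalerAl; exact: (tensor_cat (tensor_relZ _ _ _) IHt).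
Qed.

Lemma tensor_mul_seqC s t :
  tensor_rel (tensor_mul_seq s t) (tensor_mul_seq t s).
Proof.
apply: tensor_perm; rewrite /tensor_mul_seq.
elim: s t => [|x s IHs] t; first by rewrite allpairs0r.
rewrite allpairs_cons perm_sym perm_allpairs_consr perm_sym.
apply: perm_cat; last exact: IHs.
by under eq_map do rewrite [x.1 * _]mulrC [x.2 * _]mulrC.
Qed.

Lemma tensor_mul_seq_rel s s' t t' : tensor_rel s s' -> tensor_rel t t' ->
  tensor_rel (tensor_mul_seq s t) (tensor_mul_seq s' t').
Proof.
move=> ss' tt'; apply: tensor_trans (tensor_mul_seqr _ ss') _.
apply: tensor_trans (tensor_mul_seqC _ _) _.
by apply: tensor_trans (tensor_mul_seqr _ tt') _; exact: tensor_mul_seqC.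
Qed.

Lemma tensor_mul_seqA s t u :
  tensor_mul_seq s (tensor_mul_seq t u) = tensor_mul_seq (tensor_mul_seq s t) u.
Proof.
rewrite /tensor_mul_seq; elim: s => //= x s ->.
rewrite allpairs_cat; congr (_ ++ _); rewrite allpairs_mapl map_allpairs.
by apply: eq_allpairs => y z /=; rewrite !mulrA.
Qed.

Lemma tensor_opp_seqE s : tensor_opp_seq s = tensor_mul_seq [:: (-1, 1)] s.
Proof.
rewrite /tensor_mul_seq /= cats0.
by apply: eq_map => x; rewrite mulN1r mul1r.
Qed.

Lemma tensor_addNseq s : tensor_rel (tensor_opp_seq s ++ s) [::].
Proof.
elim: s => [|x s IHs] /=; first exact: tensor_refl.
apply: (@tensor_trans _ ([:: (- x.1, x.2); (x.1, x.2)] ++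
                         (tensor_opp_seq s ++ s))).
  apply: tensor_perm.
  by rewrite -surjective_pairing /= perm_cons -cat1s perm_catCA.
apply: (tensor_cat (t' := [::]) (s' := [::])) IHs.
apply: tensor_trans (tensor_sym (tensor_relDl _ _ _)) _.
by rewrite addNr; exact: tensor_rel0.
Qed.

Lemma tensor_piD s t :
  tensor_pi (s ++ t) = tensor_add (tensor_pi s) (tensor_pi t).
Proof. by apply/tensor_eqP/tensor_cat; exact/tensor_sym/tensor_repr_pi. Qed.

Lemma tensor_piN s : tensor_pi (tensor_opp_seq s) = tensor_opp (tensor_pi s).
Proof.
apply/tensor_eqP; rewrite !tensor_opp_seqE; apply: tensor_mul_seq_rel.
  exact: tensor_refl.
exact/tensor_sym/tensor_repr_pi.
Qed.

Lemma tensor_piM s t :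
  tensor_pi (tensor_mul_seq s t) = tensor_mul (tensor_pi s) (tensor_pi t).
Proof.
by apply/tensor_eqP/tensor_mul_seq_rel; exact/tensor_sym/tensor_repr_pi.
Qed.

Fact tensor_addA : associative tensor_add.
Proof.
move=> x y z; rewrite -[x]tensor_reprK -[y]tensor_reprK -[z]tensor_reprK.
by rewrite -!tensor_piD catA.
Qed.

Fact tensor_addC : commutative tensor_add.
Proof. by move=> x y; apply/tensor_eqP/tensor_perm; rewrite perm_catC. Qed.

Fact tensor_add0 : left_id tensor_zero tensor_add.
Proof. by move=> x; rewrite -[x]tensor_reprK -tensor_piD. Qed.

Fact tensor_addN : left_inverse tensor_zero tensor_opp tensor_add.
Proof.
move=> x; rewrite -[x]tensor_reprK -tensor_piN -tensor_piD.
exact/tensor_eqP/tensor_addNseq.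
Qed.

HB.instance Definition _ := GRing.isZmodule.Build tensor
  tensor_addA tensor_addC tensor_add0 tensor_addN.

Fact tensor_mulA : associative tensor_mul.
Proof.
move=> x y z; rewrite -[x]tensor_reprK -[y]tensor_reprK -[z]tensor_reprK.
by rewrite -!tensor_piM tensor_mul_seqA.
Qed.

Fact tensor_mulC : commutative tensor_mul.
Proof. by move=> x y; exact/tensor_eqP/tensor_mul_seqC. Qed.

Fact tensor_mul1 : left_id tensor_one tensor_mul.
Proof.
move=> x; rewrite -[x]tensor_reprK -tensor_piM; congr (tensor_pi _).
rewrite /tensor_mul_seq /= cats0 -[RHS]map_id.
by apply: eq_map => -[a b] /=; rewrite !mul1r.
Qed.

Fact tensor_mulDl : left_distributive tensor_mul +%R.
Proof.
move=> x y z; rewrite -[x]tensor_reprK -[y]tensor_reprK -[z]tensor_reprK.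
rewrite /GRing.add /= -tensor_piD -!tensor_piM -tensor_piD.
by rewrite /tensor_mul_seq allpairs_cat.
Qed.

HB.instance Definition _ := GRing.Zmodule_isComPzRing.Build tensor
  tensor_mulA tensor_mulC tensor_mul1 tensor_mulDl.

Definition tens (a : A) (b : B) : tensor := tensor_pi [:: (a, b)].

Lemma tensDl a a' b : tens (a + a') b = tens a b + tens a' b.
Proof.
by rewrite [RHS]/GRing.add /= -tensor_piD; exact/tensor_eqP/tensor_relDl.
Qed.

Lemma tensDr a b b' : tens a (b + b') = tens a b + tens a b'.
Proof.
by rewrite [RHS]/GRing.add /= -tensor_piD; exact/tensor_eqP/tensor_relDr.
Qed.

Lemma tensZ c a b : tens (c *: a) b = tens a (c *: b).
Proof. exact/tensor_eqP/tensor_relZ. Qed.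

Lemma tensM a a' b b' : tens (a * a') (b * b') = tens a b * tens a' b'.
Proof. by rewrite [RHS]/GRing.mul /= -tensor_piM. Qed.

Lemma tens1 : tens 1 1 = 1. Proof. by []. Qed.

Lemma tensor_sum (x : tensor) : exists s, x = \sum_(p <- s) tens p.1 p.2.
Proof.
exists (tensor_repr x); rewrite -[LHS]tensor_reprK.
elim: (tensor_repr x) => [|[a b] s IHs].
  by rewrite big_nil.
by rewrite big_cons -IHs -cat1s tensor_piD.
Qed.

Lemma tensor_lift (M : zmodType) (f : A -> B -> M) :
    (forall a a' b, f (a + a') b = f a b + f a' b) ->
    (forall a b b', f a (b + b') = f a b + f a b') ->
    (forall c a b, f (c *: a) b = f a (c *: b)) ->
  exists F : {additive tensor -> M}, forall a b, F (tens a b) = f a b.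
Proof.
move=> fDl fDr fZ; pose S s := \sum_(p <- s) f p.1 p.2.
have f0 b : f 0 b = 0 by apply: (addrI (f 0 b)); rewrite -fDl !addr0.
have SP s t : tensor_rel s t -> S s = S t.
  rewrite /S; elim=> {s t}.
  - by move=> s t st; exact: perm_big.
  - by [].
  - by move=> s t u _ -> _ ->.
  - by move=> s s' t t' _ IH1 _ IH2; rewrite !big_cat /= IH1 IH2.
  - by move=> b; rewrite big_seq1 big_nil.
  - by move=> a a' b; rewrite !big_cons !big_nil !addr0 fDl.
  - by move=> a b b'; rewrite !big_cons !big_nil !addr0 fDr.
  - by move=> c a b; rewrite !big_cons !big_nil fZ.
pose F (x : tensor) := S (tensor_repr x).
have Fpi s : F (tensor_pi s) = S s by exact/SP/tensor_repr_pi.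
have FD : {morph F : x y / x + y}.
  move=> x y; rewrite -[x]tensor_reprK -[y]tensor_reprK.
  rewrite [in LHS]/GRing.add /= -tensor_piD.
  by rewrite !Fpi /S big_cat.
have FB : zmod_morphism F.
  by move=> x y; apply: (addIr (F y)); rewrite -FD !subrK.
pose Fa := GRing.isZmodMorphism.Build tensor M F FB.
pose FF : {additive tensor -> M} := HB.pack F Fa.
by exists FF => a b; rewrite [LHS](Fpi [:: (a, b)]) /S big_seq1.
Qed.

End Tensor.

Arguments tensor {k} A B.
Arguments tens {k A B} a b.

(* The ideal m (A (x) B) + n (A (x) B). *)
Definition tensor_ideal (k : comNzRingType) (A B : comAlgType k)
    (m : set A) (n : set B) : set (tensor A B) :=
  ideal_add (ideal_gen [set tens a 1 | a in m])
            (ideal_gen [set tens 1 b | b in n]).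

Definition completed_tensor (k : comNzRingType) (A B : comAlgType k)
    (m : set A) (n : set B) : comPzRingType :=
  completion (tensor_ideal m n).

(* Main.v *)
Require Import Defs.
From HB Require Import structures.
From mathcomp Require Import all_boot all_order all_algebra.
From mathcomp Require Import boolp classical_sets functions.
From mathcomp Require Import ring.

(* Coefficientwise (contracting with k-linear functionals that kill a power of
   the other maximal ideal) the completions of A and B are retracts of the
   completed tensor product T; this gives the easy implication and shows that
   both completions are noetherian when T is.

   Conversely, let f, g in T be nonzero, with nonzero coefficients a, a' in the
   completion of A.  A prime P maximal among those avoiding the powers of a a'
   has a quotient D of dimension at most one, so that every nonzero ideal of D
   is open.  Among the k-subspaces of Frac D containing the maximal ideal of D,
   closed under product and not containing 1, Zorn's lemma gives a maximal one:
   it is the maximal ideal of a valuation ring, whose residue field is k because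
   k is algebraically closed.  The corresponding valuation v is continuous on D
   (but D need not lie in the valuation ring).  On the side of B the same
   construction, with D-submodules in place of k-subspaces, gives a continuous
   valuation w that is nonnegative on B.

   Since B is noetherian, w attains a least value on the coefficients of f in
   the completion of B; among the terms of that w-value, v has a least value,
   and as the residue field of v is k they can be grouped into one pure tensor:
   f = a0 (x) b0 + terms of larger value.  The same holds for g, and the product
   of the two leading tensors cannot be cancelled, so f g <> 0. *)

Set Implicit Arguments.
Unset Strict Implicit.
Unset Printing Implicit Defensive.

Import GRing.Theory.

Local Open Scope classical_set_scope.
Local Open Scope quotient_scope.
Local Open Scope ring_scope.

(** * Ideals of noetherian rings *)

Section IdealTheory.
Variable R : comPzRingType.
Implicit Types (I J P Q : set R) (S : set R) (s : seq R).

(** The residue fields of [A] and [B] may be arbitrary extensions of [k], which forces the asymmetry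
    between the two valuations. Grouping terms of equal value into one tensor needs residue field
    [k]; on the side of [A] this is obtained by letting only the scalars of [k] act, so elements of
    [A] may have negative value. A least value on coefficients needs the sets of large value to be
    ideals of a noetherian ring, hence a valuation ring containing [B], whose residue field can then
    not be prescribed. Terms are compared lexicographically, [w] first. Dimension one serves
    continuity: over a larger local domain the values on powers of the maximal ideal need not become
    large, and the value of a Cauchy sequence need not stabilise. Elements of the completed tensor
    product are handled as Cauchy sequences of finite sums, so a leading tensor exists only at a
    given index and accuracy; what is uniform is a bound on its values. Errors in [A] are measured
    by open ideals, which absorb multipliers of negative value. *)

Lemma ideal0 I : is_ideal I -> I 0. Proof. by case. Qed.

Lemma idealD I x y : is_ideal I -> I x -> I y -> I (x + y).
Proof. by case=> _ ID _; exact: ID. Qed.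

Lemma ideal_mull I a x : is_ideal I -> I x -> I (a * x).
Proof. by case=> _ _; exact. Qed.

Lemma ideal_mulr I a x : is_ideal I -> I x -> I (x * a).
Proof. by move=> II Ix; rewrite mulrC; exact: ideal_mull. Qed.

Lemma ideal_sum I (T : Type) (r : seq T) (F : T -> R) :
  is_ideal I -> (forall i, I (F i)) -> I (\sum_(i <- r) F i).
Proof.
move=> II IF; elim/big_ind: _ => //; first exact: ideal0.
by move=> x y; exact: (idealD II).
Qed.

Lemma sub_ideal_gen S : S `<=` ideal_gen S.
Proof. by move=> x Sx J [_]; apply. Qed.

Lemma ideal_gen_min S J : is_ideal J -> S `<=` J -> ideal_gen S `<=` J.
Proof. by move=> JI SJ x; apply. Qed.

Lemma ideal_gen_cons a s x : ideal_gen [set` a :: s] x ->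
  exists c y, ideal_gen [set` s] y /\ x = c * a + y.
Proof.
pose J := [set x | exists c y, ideal_gen [set` s] y /\ x = c * a + y].
have sI := @ideal_gen_ideal R [set` s].
apply: (@ideal_gen_min _ J).
  split.
  - by exists 0, 0; split; [exact: (ideal0 sI)|rewrite mul0r addr0].
  - move=> _ _ [c [y [sy ->]]] [d [z [sz ->]]]; exists (c + d), (y + z).
    by split; [exact: (idealD sI)|ring].
  - move=> b _ [c [y [sy ->]]]; exists (b * c), (b * y).
    by split; [exact: (ideal_mull _ sI)|ring].
move=> z; rewrite /= inE => /predU1P[->|zs].
  by exists 1, 0; split; [exact: (ideal0 sI)|rewrite mul1r addr0].
by exists 0, z; split; [exact: sub_ideal_gen|rewrite mul0r add0r].
Qed.

Lemma ideal_gen_nil x : ideal_gen [set` [::]] x -> x = 0 :> R.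
Proof.
apply: (@ideal_gen_min _ [set 0]) => //; split=> //.
  by move=> _ _ -> ->; rewrite /= addr0.
by move=> a _ ->; rewrite /= mulr0.
Qed.

Definition principal_add (a : R) I : set R :=
  [set x | exists c y, I y /\ x = c * a + y].

Lemma principal_add_ideal a I : is_ideal I -> is_ideal (principal_add a I).
Proof.
move=> II; split.
- by exists 0, 0; split; [exact: (ideal0 II)|rewrite mul0r addr0].
- move=> _ _ [c [y [sy ->]]] [d [z [sz ->]]]; exists (c + d), (y + z).
  by split; [exact: (idealD II)|ring].
- move=> b _ [c [y [sy ->]]]; exists (b * c), (b * y).
  by split; [exact: (ideal_mull _ II)|ring].
Qed.

Lemma principal_add_sub a I : I `<=` principal_add a I.
Proof. by move=> x Ix; exists 0, x; rewrite mul0r add0r. Qed.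

Lemma principal_add_gen a I : is_ideal I -> principal_add a I a.
Proof.
by move=> II; exists 1, 0; split; [exact: (ideal0 II)|rewrite mul1r addr0].
Qed.

Lemma ideal_mul_ideal I J : is_ideal (ideal_mul I J).
Proof. exact: ideal_gen_ideal. Qed.

Lemma ideal_mulP I J x y : I x -> J y -> ideal_mul I J (x * y).
Proof. by move=> Ix Jy; apply: sub_ideal_gen; exists x => //; exists y. Qed.

Lemma ideal_mul_min I J Q : is_ideal Q ->
  (forall x y, I x -> J y -> Q (x * y)) -> ideal_mul I J `<=` Q.
Proof.
move=> QI IJQ; apply: ideal_gen_min => // _ [x Ix [y Jy <-]]; exact: IJQ.
Qed.

Lemma ideal_mul_subr I J : is_ideal J -> ideal_mul I J `<=` J.
Proof. by move=> JI; apply: ideal_mul_min => // x y _; exact: ideal_mull. Qed.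

Lemma ideal_exp_sub I i j : (i <= j)%N -> ideal_exp I j `<=` ideal_exp I i.
Proof.
move=> /subnK <-; elim: (j - i)%N => [|n IH] //.
by move=> x Ix; apply: IH; exact: (ideal_mul_subr (ideal_exp_ideal I _) Ix).
Qed.

Lemma ideal_expD I i j x y : ideal_exp I i x -> ideal_exp I j y ->
  ideal_exp I (i + j) (x * y).
Proof.
elim: i x => [|i IH] x; first by move=> _ /= Iy;
  exact: (ideal_mull _ (ideal_exp_ideal _ _)).
move=> Ix Iy; move: x Ix; rewrite addSn /=.
apply: (@ideal_mul_min _ _
  [set x | ideal_mul I (ideal_exp I (i + j)) (x * y)]) => [|a b Ia Ib].
  split=> [|u v Hu Hv|a u Hu] /=.
  - by rewrite mul0r; exact: (ideal0 (ideal_mul_ideal _ _)).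
  - by rewrite mulrDl; apply: (idealD (ideal_mul_ideal _ _)).
  - by rewrite -mulrA; apply: (ideal_mull _ (ideal_mul_ideal _ _)).
by rewrite /= -mulrA; apply: ideal_mulP => //; exact: IH.
Qed.

Lemma ideal_exp1 I : is_ideal I -> ideal_exp I 1 = I.
Proof.
move=> II; rewrite eqEsubset; split=> /=.
  by apply: ideal_mul_min => // x y Ix _; exact: (ideal_mulr _ II).
by move=> x Ix; rewrite -[x]mulr1; exact: ideal_mulP.
Qed.

Lemma ideal_exp_min I n Q : is_ideal Q -> I `<=` Q ->
  ideal_exp I n `<=` ideal_exp Q n.
Proof.
move=> QI IQ; elim: n => //= n IH; apply: ideal_mul_min => [|x y Ix Iy].
  exact: ideal_mul_ideal.
by apply: ideal_mulP; [exact: IQ|exact: IH].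
Qed.

Lemma ideal_exp_addn I i j :
  ideal_exp I (i + j) `<=` ideal_mul (ideal_exp I i) (ideal_exp I j).
Proof.
elim: i => [|i IHi] y; first by move=> Iy; rewrite -[y]mul1r; exact: ideal_mulP.
apply: ideal_mul_min => [|u v Iu /IHi]; first exact: ideal_mul_ideal.
apply: (@ideal_mul_min _ _
  [set v | ideal_mul (ideal_exp I i.+1) (ideal_exp I j) (u * v)]).
  split=> [|a b Ha Hb|a b Hb] /=.
  - by rewrite mulr0; exact: (ideal0 (ideal_mul_ideal _ _)).
  - by rewrite mulrDr; apply: (idealD (ideal_mul_ideal _ _)).
  - by rewrite mulrCA; apply: (ideal_mull _ (ideal_mul_ideal _ _)).
by move=> a b Ia Ib; rewrite /= mulrA; do 2 apply: ideal_mulP => //.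
Qed.

Lemma ideal_expM I n p : ideal_exp I (n * p) `<=` ideal_exp (ideal_exp I n) p.
Proof.
elim: p => [|p IH]; first by rewrite muln0.
rewrite mulnS => x /ideal_exp_addn.
apply: ideal_mul_min => [|u v Iu Iv]; first exact: ideal_mul_ideal.
by apply: ideal_mulP => //; exact: IH.
Qed.

Lemma principal_add_exp a I n : is_ideal I ->
  ideal_exp (principal_add a I) n `<=` principal_add (a ^+ n) I.
Proof.
move=> II; elim: n => [|n IH].
  by move=> x _; exists x, 0; split;
    [exact: (ideal0 II)|rewrite expr0 mulr1 addr0].
apply: ideal_mul_min; first exact: principal_add_ideal.
move=> _ y [c [z [Iz ->]]] /IH [d [w [Iw ->]]].
exists (c * d), (c * a * w + (d * a ^+ n + w) * z).
split; last by rewrite exprS; ring.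
by apply: (idealD II); exact: (ideal_mull _ II).
Qed.

Section Noetherian.
Hypothesis noethR : noetherian R.

(** Zorn's lemma: the union of a nonempty chain is a finitely generated ideal, all of whose
    generators already lie in one member, so the union is that member. *)
Lemma noetherian_max (F : set (set R)) I0 :
  F I0 -> (forall I, F I -> is_ideal I) ->
  exists2 I, F I & forall J, F J -> I `<=` J -> J `<=` I.
Proof.
move=> FI0 Fid; pose P : set (set R) := [set X | X = set0 \/ F X].
have [|A [[A0|FA] Amax]] := @Zorn_bigcup R P.
- move=> C CP Ctot.
  have [[X [CX FX]]|noF] := pselect (exists X, C X /\ F X); last first.
    left; apply/seteqP; split=> // x [X CX Xx]; have [X0|FX] := CP _ CX.
      by rewrite X0 in Xx.
    by case: noF; exists X.
  have sub2 Y Z : C Y -> C Z -> Y `<=` Z \/ Z `<=` Y by exact: Ctot.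
  have UI : is_ideal (\bigcup_(X in C) X).
    split.
    - by exists X => //; exact: (ideal0 (Fid _ _)).
    - move=> x y [Y CY Yx] [Z CZ Zy].
      have [YZ|ZY] := sub2 _ _ CY CZ.
        exists Z => //; have [Z0|FZ] := CP _ CZ; first by rewrite Z0 in Zy.
        exact: (idealD (Fid _ FZ) (YZ _ Yx)).
      exists Y => //; have [Y0|FY] := CP _ CY; first by rewrite Y0 in Yx.
      exact: (idealD (Fid _ FY) Yx (ZY _ Zy)).
    - move=> a x [Y CY Yx]; exists Y => //.
      have [Y0|FY] := CP _ CY; first by rewrite Y0 in Yx.
      exact: (ideal_mull _ (Fid _ FY)).
  have [s Es] := noethR UI.
  have [Y [CY FY sY]] : exists Y, [/\ C Y, F Y & [set` s] `<=` Y].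
    have : [set` s] `<=` \bigcup_(X in C) X.
      by rewrite Es; exact: sub_ideal_gen.
    elim: s {Es} => [|a s IH] sU; first by exists X; split.
    have [|Y [CY FY sY]] := IH.
      by move=> z zs; apply: sU; rewrite /= inE zs orbT.
    have [Z CZ Za] : (\bigcup_(X in C) X) a by apply: sU; rewrite /= mem_head.
    have [YZ|ZY] := sub2 _ _ CY CZ.
      have [Z0|FZ] := CP _ CZ; first by rewrite Z0 in Za.
      exists Z; split=> // z; rewrite /= inE => /predU1P[->//|zs].
      exact/YZ/sY.
    exists Y; split=> // z; rewrite /= inE => /predU1P[->|zs]; first exact: ZY.
    exact: sY.
  right; suff -> : \bigcup_(X in C) X = Y by [].
  apply/seteqP; split; last exact: bigcup_sup.
  by rewrite Es; apply: ideal_gen_min => //; exact: Fid.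
- have [] := Amax I0; last by right.
  rewrite A0; split=> // /(_ 0); apply; exact: (ideal0 (Fid _ _)).
- exists A => // J FJ AJ; apply: contrapT => JA.
  by have [] := Amax J; [split|right].
Qed.

Lemma noetherian_ind (F : set (set R)) :
  (forall I, is_ideal I ->
     (forall J, is_ideal J -> I `<=` J -> ~ J `<=` I -> F J) -> F I) ->
  forall I, is_ideal I -> F I.
Proof.
move=> IH I II; apply: contrapT => nFI.
have [|J [JI nFJ] Jmax] :=
  @noetherian_max [set J | is_ideal J /\ ~ F J] I (conj II nFI).
  by move=> J [].
apply: nFJ; apply: IH => // Q QI JQ nQJ; apply: contrapT => nFQ.
by apply: nQJ; apply: Jmax.
Qed.

End Noetherian.
End IdealTheory.

Arguments principal_add_sub {R a I} [_] _.

(** * Primes of coheight one *)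

Definition prime_ideal (R : comPzRingType) (P : set R) :=
  [/\ is_ideal P, ~ P 1 & forall x y, P (x * y) -> P x \/ P y].

Section LocalNoetherian.
Variables (R : comPzRingType) (m : set R).
Hypothesis noethR : noetherian R.
Hypothesis mI : is_ideal m.
Hypothesis m1 : ~ m 1.
Hypothesis munit : forall x, ~ m x -> exists y, y * x = 1.
Implicit Types (I J P Q : set R).

Lemma unit_1sub u : m u -> exists y, y * (1 - u) = 1.
Proof.
move=> mu; apply: munit => mB; apply: m1.
by rewrite -(subrK u 1); exact: (idealD mI).
Qed.

(** Let [Q] be maximal among the ideals between [J'] and [J] that do not contain [J]. If [u * z],
    with [u] in [m] and [z] in [J], were outside [Q], then [Q + (u * z)] would contain [z], so
    [z = c * u * z + q], and the unit [1 - c * u] would put [z] in [Q]. Hence [m J] lies in [Q], and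
    so does [J]. *)
Lemma nakayama J J' : is_ideal J -> is_ideal J' -> J' `<=` J ->
  (forall z, J z -> exists z' w, [/\ J' z', ideal_mul m J w & z = z' + w]) ->
  J `<=` J'.
Proof.
move=> JI J'I J'J JE; apply: contrapT => nJJ'.
pose F := [set Q | [/\ is_ideal Q, J' `<=` Q, Q `<=` J & ~ J `<=` Q]].
have [|I []//|Q [QI J'Q QJ nJQ] Qmax] := @noetherian_max _ noethR F J'.
  by split.
apply: nJQ; suff mJQ : ideal_mul m J `<=` Q.
  move=> z /JE [z' [w [J'z' mw ->]]].
  by apply: (idealD QI); [exact: J'Q|exact: mJQ].
apply: ideal_mul_min => // u z mu Jz.
have [Q1J|nQ1J] := pselect (J `<=` principal_add (u * z) Q).
  have [c [q [Qq zE]]] := Q1J _ Jz.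
  have [v vE] := unit_1sub (ideal_mull c mI mu).
  suff -> : z = v * q by do 2 apply: (ideal_mull _ QI).
  have -> : q = (1 - c * u) * z by rewrite mulrBl mul1r {1}zE; ring.
  by rewrite mulrA vE mul1r.
apply: (Qmax (principal_add (u * z) Q)); last exact: principal_add_gen.
  split=> //; first exact: principal_add_ideal.
  - by move=> x /J'Q Qx; exact: principal_add_sub.
  - move=> _ [c [q [Qq ->]]]; apply: (idealD JI); last exact: QJ.
    by do 2 apply: (ideal_mull _ JI).
exact: principal_add_sub.
Qed.

(** This is the finite length of [R / Q], proved without lengths by enlarging [Q] with a socle
    element [g]. If [g] belongs to the whole chain, induction applies directly; otherwise it applies
    to the chain plus [(g)], started where [g] has been lost. A leftover [u * g] then lies in [Q] if
    [u] is in [m], while a unit [u] would bring [g] back. *)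
Lemma artinian_descent r Q : is_ideal Q -> ideal_exp m r `<=` Q ->
  forall L : nat -> set R, (forall n, is_ideal (L n)) ->
    (forall n, L n.+1 `<=` L n) -> (forall n, Q `<=` L n) ->
  exists n, L n `<=` L n.+1.
Proof.
move=> QI; move: Q QI; apply: (noetherian_ind noethR) => Q QI IH mQ L LI Ldec QL.
have [Q1|nQ1] := pselect (Q 1).
  by exists 0%N => x _; apply: QL; rewrite -[x]mulr1; exact: (ideal_mull _ QI).
(* Such a [g] lies in the last power of [m] that is not contained in [Q]. *)
have [g [nQg mgQ]] : exists g, ~ Q g /\ forall u, m u -> Q (u * g).
  elim: r {IH} mQ => [|r IHr] mQ; first by case: nQ1; exact: mQ.
  have [/IHr//|/existsNP[g /not_implyP[mg nQg]]] :=
    pselect (ideal_exp m r `<=` Q).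
  by exists g; split=> // u mu; apply: mQ; exact: ideal_mulP.
have Q'I := principal_add_ideal g QI.
have QQ' : Q `<=` principal_add g Q by exact: principal_add_sub.
have {}IH := IH _ Q'I QQ' (fun H => nQg (H _ (principal_add_gen g QI)))
  (fun x mx => QQ' _ (mQ _ mx)).
have Lle i j x : L (i + j)%N x -> L i x.
  by elim: j => [|j IHj]; rewrite ?addn0 ?addnS// => /Ldec.
have [Lg|/existsNP[n1 nLg]] := pselect (forall n, L n g).
  apply: IH => // n _ [c [q [Qq ->]]].
  by apply: (idealD (LI n)); [exact: (ideal_mull _ (LI n))|exact: QL].
have [n||n|n Ln] := IH (fun n => principal_add g (L (n1 + n)%N)).
- exact: principal_add_ideal.
- move=> n _ [c [q [Lq ->]]]; exists c, q; split=> //.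
  by apply: Ldec; rewrite -addnS.
- by move=> _ [c [q [Lq ->]]]; exists c, q; split=> //; exact: QL.
exists (n1 + n)%N; rewrite -addnS => z Lz.
have [u [z' [Lz' zE]]] := Ln _ (principal_add_sub Lz).
have Lug : L (n1 + n)%N (u * g).
  rewrite (_ : u * g = z - z'); last by rewrite zE; ring.
  by apply: is_idealB => //; apply: Ldec; rewrite -addnS.
rewrite zE; apply: (idealD (LI _)) => //.
have [mu|/munit[v vE]] := pselect (m u); first exact/QL/mgQ.
case: nLg; apply: (@Lle _ n); rewrite -[g]mul1r -vE -mulrA.
exact: (ideal_mull _ (LI _)).
Qed.

(** A prime filtration of [R / I]: a maximal annihilator [(I : g)] is a prime [q], and the induction
    passes to [I + (g)]. If [q] contains [m], the factor generated by [g] is killed by [m] and costs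
    one more power; otherwise [q] joins the list, and an element outside it acts injectively on that
    factor. The exponent does not depend on [d]. *)
Lemma generic_regular I : is_ideal I -> exists qs : seq (set R),
  (forall q, q \in qs -> prime_ideal q /\ ~ m `<=` q) /\
  forall y, m y -> (forall q, q \in qs -> ~ q y) ->
    exists N, forall d, I (y * d) -> forall w, ideal_exp m N w -> I (w * d).
Proof.
move: I; apply: (noetherian_ind noethR) => I II IH.
have [I1|nI1] := pselect (I 1).
  exists [::]; split=> // y _ _; exists 0%N => d _ w _.
  by rewrite -[w * d]mulr1; exact: (ideal_mull _ II).
pose colon g := [set x | I (x * g)].
have colonI g : is_ideal (colon g).
  split=> [|x y Ix Iy|a x Ix]; rewrite /colon /= ?mul0r; first exact: (ideal0 II).
    by rewrite mulrDl; exact: (idealD II).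
  by rewrite -mulrA; exact: (ideal_mull _ II).
have [||_ [g nIg <-] gmax] :=
    @noetherian_max _ noethR [set colon g | g in [set g | ~ I g]] (colon 1).
- by exists 1.
- by move=> _ [g _ <-].
have qprime : prime_ideal (colon g).
  split=> //; first by rewrite /colon /= mul1r.
  move=> x y Ixyg; have [?|nIxg] := pselect (I (x * g)); [by left|right].
  apply: (gmax (colon (x * g))); first by exists (x * g).
    by move=> z; rewrite /colon /= mulrCA; exact: (ideal_mull _ II).
  by move: Ixyg; rewrite /colon /= [x * y]mulrC mulrA.
have := IH _ (principal_add_ideal g II) (@principal_add_sub _ _ _)
  (fun H => nIg (H _ (principal_add_gen g II))).
move=> [qs [qsP qsreg]].
have [mq|nmq] := pselect (m `<=` colon g).
  exists qs; split=> // y my /(qsreg _ my)[N NP]; exists N.+1 => d Id.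
  have {}NP := NP _ (principal_add_sub Id).
  apply: (@ideal_mul_min _ _ _ [set w | I (w * d)]).
    split=> [|u v Iu Iv|a u Iu] /=; rewrite ?mul0r; first exact: (ideal0 II).
      by rewrite mulrDl; exact: (idealD II).
    by rewrite -mulrA; exact: (ideal_mull _ II).
  move=> u w mu /NP[c [i [Ii E]]]; rewrite /= -mulrA E mulrDr.
  apply: (idealD II); last exact: (ideal_mull _ II).
  by rewrite mulrCA; apply: (ideal_mull _ II); exact: mq.
exists (colon g :: qs); split=> [q|y my yq].
  by rewrite inE => /predU1P[->//|/qsP].
have [|N NP] := qsreg _ my.
  by move=> q qqs; apply: yq; rewrite inE qqs orbT.
exists N => d Id w mw.
have [c [i [Ii E]]] := NP _ (principal_add_sub Id) _ mw.
rewrite E; apply: (idealD II) => //.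
have [_ _ qpr] := qprime.
have : colon g (y * c).
  rewrite /colon /= (_ : y * c * g = w * (y * d) - y * i).
    by apply: is_idealB => //; exact: (ideal_mull _ II).
  by rewrite mulrCA E; ring.
by move=> /qpr[yg|//]; case: (yq (colon g)); rewrite ?mem_head.
Qed.

(** The primes may contain one another, so powers replace products. A prime without [y] contains
    [z + y ^+ j.+1] for at most one [j], because two such elements differ by a power of [y] times a
    unit; a large [j] therefore suits all earlier primes, and [z] takes care of the new one. *)
Lemma prime_avoidance (qs : seq (set R)) :
  (forall q, q \in qs -> prime_ideal q /\ ~ m `<=` q) ->
  exists2 y, m y & forall q, q \in qs -> ~ q y.
Proof.
elim: qs => [_|q qs IH qsP]; first by exists 0 => //; exact: (ideal0 mI).
have {}IH := IH (fun p pqs => qsP p (@mem_behead _ (q :: qs) p pqs)).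
have [y my yqs] := IH.
have [qy|nqy] := pselect (q y); last first.
  by exists y => // p; rewrite inE => /predU1P[->//|/yqs].
have [[qI _ _] /existsNP[z /not_implyP[mz nqz]]] := qsP _ (mem_head _ _).
have [J JP] : exists J : nat, forall j, (J <= j)%N -> forall p, p \in qs ->
    ~ p (z + y ^+ j.+1).
  have {}qsP p : p \in qs -> prime_ideal p.
    by move=> pqs; have [] := qsP p _; rewrite // inE pqs orbT.
  elim: qs qsP yqs {IH} => [|p qs IH] qsP yqs; first by exists 0%N.
  have [||J JP] := IH.
  - by move=> p' H; apply: qsP; rewrite inE H orbT.
  - by move=> p' H; apply: yqs; rewrite inE H orbT.
  have [[j0 pj0]|np] := pselect (exists j, p (z + y ^+ j.+1)); last first.
    exists J => j Jj p'; rewrite inE => /predU1P[->|]; last exact: JP.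
    by move=> H; apply: np; exists j.
  exists (maxn J j0.+1) => j; rewrite geq_max => /andP[Jj j0j] p'.
  rewrite inE => /predU1P[->|]; last exact: JP.
  have [pI p1 ppr] := qsP _ (mem_head _ _).
  move=> pj; apply: (yqs p (mem_head _ _)).
  have py i : p (y ^+ i) -> p y.
    by elim: i => [|i IHi]; [|rewrite exprS => /ppr[|/IHi]].
  apply: (py j0.+1).
  have [v vE] : exists v, v * (1 - y ^+ (j - j0)) = 1.
    apply: unit_1sub; rewrite -(subnSK j0j) exprS; exact: (ideal_mulr _ mI my).
  have -> : y ^+ j0.+1 = v * ((z + y ^+ j0.+1) - (z + y ^+ j.+1)).
    rewrite -{1}[y ^+ j0.+1]mul1r -vE -mulrA; congr (_ * _).
    have -> : y ^+ j.+1 = y ^+ j0.+1 * y ^+ (j - j0).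
      by rewrite -exprD addSn subnKC // ltnW.
    by ring.
  by apply: (ideal_mull _ pI); exact: is_idealB.
exists (z + y ^+ J.+1); first by apply: (idealD mI) => //; rewrite exprS;
  exact: (ideal_mulr _ mI my).
move=> p; rewrite inE => /predU1P[->|]; last exact: JP.
move=> H; apply: nqz; rewrite -(addrK (y ^+ J.+1) z); apply: is_idealB => //.
by rewrite exprS; exact: (ideal_mulr _ qI qy).
Qed.

(** Inverting [c] turns [R / P] into a field, and a noetherian local domain with this property has
    dimension at most one. The last clause states that dimension bound as openness of every ideal
    strictly larger than [P]. *)
Lemma coheight_one_prime c : (forall n, c ^+ n != 0) -> exists P : set R,
  [/\ prime_ideal P, ~ P c &
      forall a, ~ P a -> exists N, ideal_exp m N `<=` principal_add a P].
Proof.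
move=> cn0.
pose F := [set P | is_ideal P /\ forall n, ~ P (c ^+ n)].
have [||P [PI Pc] Pmax] := @noetherian_max _ noethR F [set 0].
- split; last by move=> n /eqP; rewrite (negbTE (cn0 n)).
  split=> // [x y -> ->|a x ->]; by rewrite /= ?addr0 ?mulr0.
- by move=> I [].
have grow a : ~ P a -> exists n, principal_add a P (c ^+ n).
  move=> nPa; apply: contrapT => /forallNP H; apply: nPa.
  apply: (Pmax (principal_add a P)); last exact: principal_add_gen.
    by split=> //; exact: principal_add_ideal.
  exact: principal_add_sub.
have nP1 : ~ P 1 by have := Pc 0%N.
have Ppr x y : P (x * y) -> P x \/ P y.
  move=> Pxy; apply: contrapT => /not_orP[/grow[i [u [p [Pp Ei]]]]
    /grow[j [v [q [Pq Ej]]]]].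
  apply: (Pc (i + j)%N); rewrite exprD Ei Ej.
  rewrite (_ : _ * _ = u * v * (x * y) + (u * x + p) * q + v * y * p); last ring.
  by do 2 ?apply: (idealD PI); apply: (ideal_mull _ PI).
have cancelc n x : P (c ^+ n * x) -> P x by move=> /Ppr[/Pc|].
have Pc1 : ~ P c := Pc 1%N.
exists P; split=> //.
(* Each [(a) + P] contains a power of [c], so one bound for [c] yields a bound for every [a]. *)
suff [N mN] : exists N, ideal_exp m N `<=` principal_add c P.
  move=> a /grow[s cs]; exists (N * s)%N => x /ideal_expM.
  move=> /(ideal_exp_min (principal_add_ideal c PI) mN).
  move=> /(principal_add_exp PI) [u [p [Pp ->]]].
  apply: (idealD (principal_add_ideal a PI)); last exact: principal_add_sub.
  exact: (ideal_mull _ (principal_add_ideal a PI)).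
have [mc|/munit[v vE]] := pselect (m c); last first.
  by exists 0%N => x _; exists (x * v), 0; split;
    [exact: (ideal0 PI)|rewrite -mulrA vE; ring].
pose I := principal_add c P; have II : is_ideal I := principal_add_ideal c PI.
have [qs [qsP qsreg]] := generic_regular II.
have nmP : ~ m `<=` P by move=> /(_ c mc).
have [|y my yqs] := @prime_avoidance (P :: qs).
  by move=> q; rewrite inE => /predU1P[->//|/qsP].
have nPy : ~ P y by apply: yqs; rewrite mem_head.
have [|N NP] := qsreg _ my.
  by move=> q qqs; apply: yqs; rewrite inE qqs orbT.
have [s cs] := grow _ nPy.
pose Y := principal_add y P; have YI : is_ideal Y := principal_add_ideal y PI.
(* Powers of [c] are traded for powers of [m], starting from [c ^+ s] in [Y]: each factor in [m ^ N]
   removes one [c], because [y] is generic modulo [(c) + P] and [c] can be cancelled modulo [P]. *)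
have mY : ideal_exp m (N * s) `<=` Y.
  suff H j w : ideal_exp m (N * j) w -> (j <= s)%N -> Y (c ^+ (s - j) * w).
    by move=> w /H/(_ (leqnn s)); rewrite subnn mul1r.
  elim: j w => [|j IH] w.
    by move=> _ _; rewrite subn0; exact: (ideal_mulr _ YI).
  move=> mw js; move: mw; rewrite mulnS => mw.
  move: mw => /ideal_exp_addn.
  apply: (@ideal_mul_min _ _ _ [set w | Y (c ^+ (s - j.+1) * w)]).
    split=> [|a b Ha Hb|a b Hb] /=.
    - by rewrite mulr0; exact: (ideal0 YI).
    - by rewrite mulrDr; exact: (idealD YI).
    - by rewrite mulrCA; exact: (ideal_mull _ YI).
  move=> u w' mu mw' /=; have [d [p [Pp E]]] := IH _ mw' (ltnW js).
  have sE : (s - j = (s - j.+1).+1)%N by rewrite subnSK.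
  have [|e [p' [Pp' E']]] := NP d _ u mu.
    exists (c ^+ (s - j.+1) * w'), (- p); split; first exact: is_idealN.
    by rewrite mulrAC -exprSr -sE E; ring.
  exists e, (c ^+ (s - j.+1) * (u * w') - e * y); split; last by ring.
  apply: (@cancelc 1%N).
  rewrite expr1 (_ : c * _ = u * (c ^+ (s - j) * w') - e * c * y); last first.
    by rewrite sE exprS; ring.
  rewrite E (_ : _ - _ = y * (u * d - e * c) + u * p); last ring.
  apply: (idealD PI); apply: (ideal_mull _ PI) => //.
  by rewrite E' (_ : _ - _ = p') //; ring.
(* Krull's principal ideal theorem in disguise: modulo [P], the saturations [J n]
   of [c ^+ n] by [y] become constant, by Artinian descent modulo [y] and
   Nakayama, so that a power of [y] is a multiple of [c]. *)
pose J n := [set z | exists t, principal_add (c ^+ n) P (y ^+ t * z)].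
have JI n : is_ideal (J n).
  have cI := principal_add_ideal (c ^+ n) PI.
  split.
  - by exists 0%N; rewrite mulr0; exact: (ideal0 cI).
  - move=> a b [t ta] [t' tb]; exists (t + t')%N; rewrite exprD.
    rewrite (_ : _ * _ = y ^+ t' * (y ^+ t * a) + y ^+ t * (y ^+ t' * b));
      last ring.
    by apply: (idealD cI); exact: (ideal_mull _ cI).
  - by move=> a b [t tb]; exists t; rewrite mulrCA; exact: (ideal_mull _ cI).
have Jdec n : J n.+1 `<=` J n.
  move=> z [t [u [p [Pp E]]]]; exists t, (u * c), p; split=> //.
  by rewrite E exprS; ring.
have PJ n : P `<=` J n.
  by move=> p Pp; exists 0%N; rewrite mul1r; exact: principal_add_sub.
have [|||n Jn] := @artinian_descent (N * s) Y YI mY (fun n =>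
  principal_add y (J n)).
- by move=> n; exact: principal_add_ideal.
- by move=> n _ [u [z [Jz ->]]]; exists u, z; split=> //; exact: Jdec.
- by move=> n _ [u [z [Pz ->]]]; exists u, z; split=> //; exact: PJ.
have JJ : J n `<=` J n.+1.
  apply: nakayama => // z Jz.
  have [w [z' [Jz' E]]] := Jn _ (principal_add_sub Jz).
  exists z', (y * w); split=> //; last by rewrite E; ring.
  apply: ideal_mulP => //.
  have [t tJ] : J n (y * w).
    by rewrite (_ : y * w = z - z');
      [exact: is_idealB (JI n) Jz (Jdec _ _ Jz')|rewrite E; ring].
  by exists t.+1; rewrite exprSr -mulrA.
have [t [e [p [Pp E]]]] : J n.+1 (c ^+ n).
  by apply: JJ; exists 0%N; rewrite mul1r; exact: principal_add_gen.
have It : I (y ^+ t).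
  exists e, (y ^+ t - e * c); split; last ring.
  apply: (@cancelc n); rewrite (_ : _ * _ = p) //.
  by rewrite mulrBr mulrC E exprS; ring.
exists (N * s * t)%N => x /ideal_expM /(ideal_exp_min YI mY).
move=> /(principal_add_exp PI) [u [p' [Pp' ->]]].
apply: (idealD II); first exact: (ideal_mull _ II).
exact: principal_add_sub.
Qed.

End LocalNoetherian.

(** * Residue fields of primes *)

Section ResidueField.
Variables (R : comNzRingType) (P : set R).
Hypothesis primeP : prime_ideal P.

Definition prime_pred : {pred R} := fun x => `[< P x >].

Fact prime_pred_idealr : idealr_closed prime_pred.
Proof.
have [PI P1 _] := primeP; split; first exact/asboolP/(ideal0 PI).
  by apply/asboolP.
move=> a u v /asboolP Pu /asboolP Pv; apply/asboolP.
by apply: (idealD PI) => //; exact: (ideal_mull _ PI).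
Qed.

Fact prime_pred_prime : prime_idealr_closed prime_pred.
Proof.
have [_ _ Ppr] := primeP.
move=> u v /asboolP/Ppr[Pu|Pv]; apply/orP; [left|right]; exact/asboolP.
Qed.

HB.instance Definition _ := isIdealr.Build R prime_pred prime_pred_idealr.
HB.instance Definition _ :=
  isPrimeIdealrClosed.Build R prime_pred prime_pred_prime.

Definition prime_quot : Type := Quotient.quot prime_pred.
HB.instance Definition _ := GRing.ComNzRing.on prime_quot.

Definition prime_quot_unit (x : prime_quot) : bool := `[< exists y, y * x = 1 >].
Definition prime_quot_inv (x : prime_quot) : prime_quot :=
  if pselect (exists y, y * x = 1) is left ex then projT1 (cid ex) else x.

Fact prime_quot_mulVx : {in prime_quot_unit, left_inverse 1 prime_quot_inv *%R}.
Proof.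
move=> x /asboolP ux; rewrite /prime_quot_inv; case: pselect => // ex.
by case: (cid ex).
Qed.

Fact prime_quot_unitP (x y : prime_quot) : y * x = 1 -> prime_quot_unit x.
Proof. by move=> yx; apply/asboolP; exists y. Qed.

Fact prime_quot_inv_out :
  {in [predC prime_quot_unit], prime_quot_inv =1 id}.
Proof.
move=> x /negP nux; rewrite /prime_quot_inv; case: pselect => // ux.
by case: nux; apply/asboolP.
Qed.

HB.instance Definition _ := GRing.ComNzRing_hasMulInverse.Build prime_quot
  prime_quot_mulVx prime_quot_unitP prime_quot_inv_out.

Fact prime_quot_idomain : GRing.integral_domain_axiom prime_quot.
Proof. exact: Quotient.rquot_IdomainAxiom. Qed.

HB.instance Definition _ := GRing.ComUnitRing_isIntegral.Build prime_quot
  prime_quot_idomain.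

Lemma prime_residue_field_nz :
  exists (K : fieldType) (phi : {rmorphism R -> K}), forall x, phi x = 0 <-> P x.
Proof.
pose pi : {rmorphism R ->
  Quotient.quot prime_pred} := \pi_(Quotient.quot prime_pred).
pose pi' : R -> prime_quot := pi.
have piB : zmod_morphism pi' by exact: (rmorphB pi).
have piM : monoid_morphism pi' by split;
  [exact: (rmorph1 pi)|exact: (rmorphM pi)].
pose pi1 := GRing.isZmodMorphism.Build R prime_quot pi' piB.
pose pi2 := GRing.isMonoidMorphism.Build R prime_quot pi' piM.
pose pi3 : {rmorphism R -> prime_quot} := HB.pack pi' pi1 pi2.
exists {fraction prime_quot}, (@tofrac prime_quot \o pi3 : {rmorphism _ ->
  _}) => x.
split.
  move=> /= /eqP; rewrite tofrac_eq0 => /eqP E.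
  have /eqP : pi x = pi 0 by rewrite rmorph0; exact: E.
  by rewrite -Quotient.idealrBE subr0 => /asboolP.
move=> Px; rewrite /= (_ : pi' x = 0) ?rmorph0 //.
have /eqP : pi x == pi 0 by rewrite -Quotient.idealrBE subr0; exact/asboolP.
by rewrite rmorph0.
Qed.

End ResidueField.

Lemma prime_residue_field (R : comPzRingType) (P : set R) : prime_ideal P ->
  exists (K : fieldType) (phi : {rmorphism R -> K}), forall x, phi x = 0 <-> P x.
Proof.
move=> primeP; have [PI P1 _] := primeP.
have R10 : 1 != 0 :> R.
  by apply/eqP => E; apply: P1; rewrite E; exact: (ideal0 PI).
pose R' : comNzRingType := HB.pack (GRing.ComPzRing.sort R)
  (GRing.PzSemiRing_isNonZero.Build R R10).
exact: (@prime_residue_field_nz R' P primeP).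
Qed.

(** * Places *)

Section Places.
Variables (K : fieldType) (S0 : set K).
Implicit Types (I J M : set K).

(* A valuation ring is encoded by its maximal ideal alone, a maximal subplace;
   the ring itself is recovered as [stabilizer] below. *)
Record subplace I : Prop := Subplace {
  subplace0 : I 0;
  subplaceD : forall x y, I x -> I y -> I (x + y);
  subplaceN : forall x, I x -> I (- x);
  subplaceM : forall x y, I x -> I y -> I (x * y);
  subplaceS : forall s x, S0 s -> I x -> I (s * x);
  subplace1 : ~ I 1 }.

Definition place M :=
  subplace M /\ forall J, subplace J -> M `<=` J -> J `<=` M.

Definition stabilizer M : set K := [set x | forall y, M y -> M (x * y)].

Lemma exists_place I : subplace I -> exists2 M, place M & I `<=` M.
Proof.
move=> sI; pose P : set (set K) := [set X | X = set0 \/ (subplace X /\ I `<=` X)].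
have [|M [[M0|[sM IM]] Mmax]] := @Zorn_bigcup K P.
- move=> C CP Ctot.
  have [[X [CX [sX IX]]]|noX] :=
      pselect (exists X, C X /\ (subplace X /\ I `<=` X)); last first.
    left; apply/seteqP; split=> // x [X CX Xx]; have [X0|HX] := CP _ CX.
      by rewrite X0 in Xx.
    by case: noX; exists X.
  have CS Y y : C Y -> Y y -> subplace Y.
    by move=> /CP[->//|[]].
  have both x y : (\bigcup_(X in C) X) x -> (\bigcup_(X in C) X) y ->
      exists Y, [/\ C Y, subplace Y, Y x & Y y].
    move=> [Y CY Yx] [Z CZ Zy]; have [YZ|ZY] := Ctot _ _ CY CZ.
      by exists Z; split=> //; [exact: CS Zy|exact: YZ].
    by exists Y; split=> //; [exact: CS Yx|exact: ZY].
  right; split; last by move=> x Ix; exists X => //; exact: IX.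
  split.
  + by exists X => //; exact: (subplace0 sX).
  + move=> x y Cx Cy; have [Y [CY sY Yx Yy]] := both _ _ Cx Cy; exists Y => //;
    exact: (subplaceD sY).
  + by move=> x [Y CY Yx]; exists Y => //; apply: (subplaceN (CS _ _ CY Yx)).
  + move=> x y Cx Cy; have [Y [CY sY Yx Yy]] := both _ _ Cx Cy; exists Y => //;
    exact: (subplaceM sY).
  + move=> s x Ss [Y CY Yx]; exists Y => //.
    exact: (subplaceS (CS _ _ CY Yx)).
  + by move=> [Y CY Y1]; case: (CS _ _ CY Y1).
- have [] := Mmax I; last by right; split.
  by rewrite M0; split=> // /(_ 0); apply; exact: (subplace0 sI).
- exists M => //; split=> // J sJ MJ; apply: contrapT => JM.
  by have [] := Mmax J; [split|right; split=> // x /IM/MJ].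
Qed.

Section PlaceTheory.
Variable M : set K.
Hypothesis placeM : place M.
Let sM : subplace M := placeM.1.
Let Mmax := placeM.2.
Local Notation V := (stabilizer M).

Lemma place_sub_stabilizer x : M x -> V x.
Proof. by move=> Mx y My; exact: (subplaceM sM). Qed.

Lemma scalars_sub_stabilizer s : S0 s -> V s.
Proof. by move=> Ss y My; exact: (subplaceS sM). Qed.

Lemma stabilizer1 : V 1. Proof. by move=> y; rewrite mul1r. Qed.

Lemma stabilizerD x y : V x -> V y -> V (x + y).
Proof.
by move=> Vx Vy z Mz; rewrite mulrDl; apply: (subplaceD sM);
  [exact: Vx|exact: Vy].
Qed.

Lemma stabilizerN x : V x -> V (- x).
Proof. by move=> Vx z Mz; rewrite mulNr; apply: (subplaceN sM); exact: Vx. Qed.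

Lemma stabilizerM x y : V x -> V y -> V (x * y).
Proof. by move=> Vx Vy z Mz; rewrite -mulrA; apply/Vx/Vy. Qed.

Lemma stabilizerX x n : V x -> V (x ^+ n).
Proof.
move=> Vx; elim: n => [|n IH]; first exact: stabilizer1.
by rewrite exprS; exact: stabilizerM.
Qed.

(** Allowing powers of [s = 1 - u] as denominators does not leave [M]: the enlarged set is a
    subplace, since [s ^+ j] is congruent to 1 modulo [M] and so never in [M]. *)
Lemma stabilizerV1sub u : M u -> V (1 - u)^-1.
Proof.
move=> Mu; set s := 1 - u.
have Vs : V s.
  by apply: stabilizerD stabilizer1 _; exact/stabilizerN/place_sub_stabilizer.
have s0 : s != 0.
  by apply/eqP => /subr0_eq E; apply: (subplace1 sM); rewrite E.
pose M' := [set z | exists j, M (z * s ^+ j)].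
suff M'M : M' `<=` M.
  move=> y My; apply: M'M; exists 1%N.
  by rewrite expr1 mulrAC mulVf ?mul1r.
have Ms j z : M z -> M (z * s ^+ j).
  by move=> Mz; rewrite mulrC; exact: stabilizerX.
apply: Mmax; last by move=> z Mz; exists 0%N; rewrite expr0 mulr1.
split.
- by exists 0%N; rewrite mul0r; exact: (subplace0 sM).
- move=> x y [i Hx] [j Hy]; exists (i + j)%N; rewrite mulrDl.
  apply: (subplaceD sM); first by rewrite exprD mulrA; exact: Ms.
  by rewrite addnC exprD mulrA; exact: Ms.
- by move=> x [i Hx]; exists i; rewrite mulNr; exact: (subplaceN sM).
- move=> x y [i Hx] [j Hy]; exists (i + j)%N; rewrite exprD mulrACA.
  exact: (subplaceM sM).
- by move=> c x Sc [i Hx]; exists i; rewrite -mulrA; exact: (subplaceS sM).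
- move=> [j]; rewrite mul1r; elim: j => [|j IH]; first exact: (subplace1 sM).
  rewrite exprS mulrBl mul1r => H; apply: IH.
  rewrite -(subrK (u * s ^+ j) (s ^+ j)); apply: (subplaceD sM) => //.
  exact: Ms.
Qed.

Definition place_poly (p : {poly K}) := forall i, M p`_i.

(** The degree descent of Chevalley's extension theorem: the relation for the inverse of [x] lowers
    the degree of the relation for [x]. Coefficients stay in [M] because [1 - q_0] is invertible in
    the stabilizer. *)
Lemma place_no_inverse_pair n (x : K) (p q : {poly K}) :
  (size p + size q <= n)%N -> x != 0 -> place_poly p -> place_poly q ->
  p.[x] = 1 -> q.[x^-1] = 1 -> False.
Proof.
elim: n x p q => [|n IH] x p q.
  rewrite leqn0 addn_eq0 size_poly_eq0 => /andP[/eqP-> _] _ _ _.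
  by rewrite horner0 => /esym/eqP; rewrite oner_eq0.
wlog qp : x p q / (size q <= size p)%N => [wl|] pqn x0 pM qM px qx.
  have [qp|/ltnW pq] := leqP (size q) (size p); first exact: (wl x p q).
  by apply: (wl x^-1 q p) => //; rewrite ?invr_eq0 ?invrK// addnC.
case sp : (size p) => [|[|N]].
- move/eqP: sp px; rewrite size_poly_eq0 => /eqP ->.
  by rewrite horner0 => /esym/eqP; rewrite oner_eq0.
- move: px; rewrite (size1_polyC (eq_leq sp)) hornerC => p0.
  by apply: (subplace1 sM); rewrite -p0; exact: pM.
set r := (1 - q`_0)^-1.
have Vr : V r by exact/stabilizerV1sub/qM.
have q01 : 1 - q`_0 != 0.
  by apply/eqP => /subr0_eq E; apply: (subplace1 sM); rewrite E; exact: qM.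
(* Multiplied by [x ^+ N.+1], the relation [q.[x^-1] = 1] expresses [(1 - q_0) * x ^+ N.+1] through
   lower powers of [x]; [c] comes from substituting this in the top term of [p]. *)
pose c i := p`_i + r * (p`_N.+1 * q`_(N.+1 - i)).
apply: (IH x (\poly_(i < N.+1) c i) q) => //.
- apply: leq_trans (leq_add (size_poly _ _) (leqnn _)) _.
  by rewrite -ltnS -addSn -sp.
- move=> i; rewrite coef_poly; case: ifP => _; last exact: (subplace0 sM).
  by apply: (subplaceD sM) => //; apply: Vr; exact: (subplaceM sM).
rewrite horner_poly /c -px horner_coef sp [RHS]big_ord_recr /=.
under eq_bigr do rewrite mulrDl.
rewrite big_split /=; congr (_ + _).
have qN : (size q <= N.+2)%N by rewrite -sp.
have E1 : r * (1 - q`_0) = 1 by rewrite mulVf.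
have E2 : 1 - q`_0 = \sum_(i < N.+1) q`_(N.+1 - i) * x^-1 ^+ (N.+1 - i).
  rewrite -{1}qx (horner_coef_wide _ qN) big_ord_recl /= expr0 mulr1.
  rewrite addrC addKr [RHS](reindex_inj rev_ord_inj) /=; apply: eq_bigr => i _.
  by rewrite /= subSS subSn ?leq_subr// subKn// -ltnS.
rewrite -[RHS]mul1r -E1 E2 mulrAC mulr_sumr; apply: eq_bigr => i _.
have <- : x ^+ N.+1 * x^-1 ^+ (N.+1 - i) = x ^+ i.
  rewrite -{1}(subnK (ltnW (ltn_ord i))) exprD mulrAC -exprMn mulfV// expr1n
    mul1r.
  by [].
ring.
Qed.

(** This makes the stabilizer a valuation ring with maximal ideal [M]. Outside the stabilizer, [x]
    satisfies a relation [p.[x] = 1] over [M]; its inverse cannot satisfy one too, so it stabilizes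
    [M]. Then [M + x^-1 V] is a subplace, hence contained in [M]. *)
Lemma notin_stabilizer_inv x : ~ V x -> M x^-1.
Proof.
move=> nVx.
have x0 : x != 0.
  by apply/eqP => x0; apply: nVx; rewrite x0 => y; rewrite mul0r => _;
    exact: (subplace0 sM).
(* Otherwise the values at [z] of polynomials over [M] would form a subplace containing [M], hence
   equal to it, and [z] would stabilize [M]. *)
have polyP z : ~ V z -> exists2 p, place_poly p & p.[z] = 1.
  move=> nVz; pose J := [set p.[z] | p in place_poly].
  have [//|nJ1] := pselect (J 1); case: nVz => y My; rewrite mulrC.
  suff JM : J `<=` M.
    apply: JM; exists (y *: 'X); last by rewrite hornerZ hornerX.
    move=> i; rewrite coefZ coefX; case: eqP => _; rewrite ?mulr1// mulr0.
    exact: (subplace0 sM).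
  apply: Mmax; last first.
    move=> u Mu; exists u%:P; last by rewrite hornerC.
    by move=> i; rewrite coefC; case: eqP => // _; exact: (subplace0 sM).
  split=> //.
  - exists 0; last by rewrite horner0.
    by move=> i; rewrite coef0; exact: (subplace0 sM).
  - move=> _ _ [p Mp <-] [q Mq <-]; exists (p + q); last by rewrite hornerD.
    by move=> i; rewrite coefD; exact: (subplaceD sM).
  - move=> _ [p Mp <-]; exists (- p); last by rewrite hornerN.
    by move=> i; rewrite coefN; exact: (subplaceN sM).
  - move=> _ _ [p Mp <-] [q Mq <-]; exists (p * q); last by rewrite hornerM.
    move=> i; rewrite coefM; elim/big_ind: _ => //; first exact: (subplace0 sM).
      exact: (subplaceD sM).
    by move=> j _; exact: (subplaceM sM).
  - move=> s _ Ss [p Mp <-]; exists (s *: p); last by rewrite hornerZ.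
    by move=> i; rewrite coefZ; exact: (subplaceS sM).
have Vx1 : V x^-1.
  apply: contrapT => /polyP[q Mq qx]; have [p Mp px] := polyP _ nVx.
  exact: (@place_no_inverse_pair _ x p q (leqnn _)).
pose J := [set z | exists u v, [/\ M u, V v & z = u + x^-1 * v]].
suff JM : J `<=` M.
  apply: JM; exists 0, 1; split; first exact: (subplace0 sM).
    exact: stabilizer1.
  by rewrite add0r mulr1.
apply: Mmax; last first.
  move=> u Mu; exists u, 0; split=> //; last by rewrite mulr0 addr0.
  by move=> y _; rewrite mul0r; exact: (subplace0 sM).
split.
- exists 0, 0; split; first exact: (subplace0 sM).
    by move=> y _; rewrite mul0r; exact: (subplace0 sM).
  by rewrite mulr0 addr0.
- move=> _ _ [u [v [Mu Vv ->]]] [u' [v' [Mu' Vv' ->]]].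
  exists (u + u'), (v + v'); split;
    [exact: (subplaceD sM)|exact: stabilizerD|ring].
- move=> _ [u [v [Mu Vv ->]]]; exists (- u), (- v).
  split; [exact: (subplaceN sM)|exact: stabilizerN|ring].
- move=> _ _ [u [v [Mu Vv ->]]] [u' [v' [Mu' Vv' ->]]].
  exists (u * u'), (u * v' + v * u' + x^-1 * v * v').
  split; [exact: (subplaceM sM)| |ring].
  apply: stabilizerD; last by do 2?apply: stabilizerM.
  by apply: stabilizerD; apply: stabilizerM => //; exact: place_sub_stabilizer.
- move=> s _ Ss [u [v [Mu Vv ->]]]; exists (s * u), (s * v).
  split; [exact: (subplaceS sM)| |ring].
  by apply: stabilizerM => //; exact: scalars_sub_stabilizer.
- move=> [u [v [Mu Vv E]]]; apply: nVx.
  have Ev : v = x * (1 - u) by rewrite E [u + _]addrC addrK mulrA mulfV// mul1r.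
  rewrite (_ : x = v * (1 - u)^-1); first by apply: stabilizerM => //;
    exact: stabilizerV1sub.
  rewrite Ev mulfK//; apply/eqP => /subr0_eq u1.
  by apply: (subplace1 sM); rewrite u1.
Qed.

Lemma stabilizer_unit x : V x -> ~ M x -> V x^-1.
Proof.
move=> Vx nMx; apply: contrapT => /notin_stabilizer_inv; by rewrite invrK.
Qed.

Lemma stabilizer_total x y : x != 0 -> y != 0 -> ~ V (x / y) -> M (y / x).
Proof. by move=> x0 y0 /notin_stabilizer_inv; rewrite invf_div. Qed.

End PlaceTheory.
End Places.

(** Since only [k] acts, [M + (x - c) k[x]] is a competitor of [M] for every [c]. If no [x - c] is
    in [M], each competitor contains 1, so each [x - c] is invertible modulo [M]. The case [c = 0]
    gives a nonzero polynomial [q] with [q.[x]] in [M]; it splits into linear factors, all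
    invertible modulo [M], and 1 falls into [M]. *)
Lemma place_residue (k : closedFieldType) (K : fieldType)
    (kap : {rmorphism k -> K}) (M : set K) (x : K) :
  place (range kap) M -> stabilizer M x -> exists c, M (x - kap c).
Proof.
move=> pM Vx; have [sM Mmax] := pM.
have Vk c : stabilizer M (kap c).
  by apply: (scalars_sub_stabilizer pM); exists c.
have Vp (p : {poly k}) : stabilizer M (map_poly kap p).[x].
  elim/poly_ind: p => [|p c IH].
    by rewrite rmorph0 horner0 -(rmorph0 kap).
  rewrite rmorphD rmorphM /= map_polyX map_polyC !hornerE.
  exact: (stabilizerD pM (stabilizerM IH Vx) (Vk c)).
pose J c := [set z | exists y (p : {poly k}),
  M y /\ z = y + (x - kap c) * (map_poly kap p).[x]].
apply: contrapT => nex.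
have J1 c : exists p : {poly k}, M (1 - (x - kap c) * (map_poly kap p).[x]).
  apply: contrapT => np; apply: nex; exists c.
  suff JM : J c `<=` M.
    apply: JM; exists 0, 1; split; first exact: (subplace0 sM).
    by rewrite rmorph1 hornerC mulr1 add0r.
  have Vc : stabilizer M (x - kap c).
    exact: (stabilizerD pM Vx (stabilizerN pM (Vk c))).
  have Vcp p : stabilizer M ((x - kap c) * (map_poly kap p).[x]).
    exact: (stabilizerM Vc (Vp p)).
  apply: Mmax; last first.
    by move=> u Mu; exists u, 0; split; rewrite ?rmorph0 ?horner0 ?mulr0 ?addr0.
  split.
  - exists 0, 0; split; first exact: (subplace0 sM).
    by rewrite rmorph0 horner0 mulr0 addr0.
  - move=> _ _ [u [p [Mu ->]]] [v [q [Mv ->]]]; exists (u + v), (p + q).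
    split; first exact: (subplaceD sM).
    by rewrite rmorphD hornerD; ring.
  - move=> _ [u [p [Mu ->]]]; exists (- u), (- p).
    split; first exact: (subplaceN sM).
    by rewrite rmorphN hornerN; ring.
  - move=> _ _ [u [p [Mu ->]]] [v [q [Mv ->]]].
    exists (u * v + ((x - kap c) * (map_poly kap p).[x]) * v
            + ((x - kap c) * (map_poly kap q).[x]) * u), (('X - c%:P) * p * q).
    split.
      apply: (subplaceD sM); last exact: Vcp.
      by apply: (subplaceD sM); [exact: (subplaceM sM)|exact: Vcp].
    rewrite rmorphM rmorphM rmorphB /= map_polyX map_polyC.
    by rewrite !hornerM hornerXsubC; ring.
  - move=> _ _ [d _ <-] [u [p [Mu ->]]]; exists (kap d * u), (d%:P * p).
    split; first exact: Vk.
    by rewrite rmorphM /= map_polyC hornerM hornerC; ring.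
  - move=> [u [p [Mu E]]]; apply: np; exists p.
    by rewrite E addrK.
have invprod (s : seq k) : exists2 v, stabilizer M v &
    M (1 - v * (map_poly kap (\prod_(z <- s) ('X - z%:P))).[x]).
  elim: s => [|c s [v Vv Mv]].
    exists 1; first exact: stabilizer1.
    by rewrite big_nil rmorph1 hornerC mulr1 subrr; exact: (subplace0 sM).
  have [p Mp] := J1 c; pose w := (map_poly kap p).[x].
  exists (v * w); first exact: (stabilizerM Vv (Vp p)).
  rewrite big_cons rmorphM rmorphB /= map_polyX map_polyC hornerM hornerXsubC.
  set t := (map_poly _ _).[x] in Mv *.
  rewrite (_ : _ - _ = (1 - v * t) + v * t * (1 - (x - kap c) * w)); last ring.
  apply: (subplaceD sM) => //; exact: (stabilizerM Vv (Vp _)).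
have [p] := J1 0; rewrite rmorph0 subr0 => Mp.
pose q : {poly k} := 1 - 'X * p.
have Mq : M (map_poly kap q).[x].
  by rewrite rmorphB rmorphM /= rmorph1 map_polyX !hornerE.
have q0 : q != 0.
  apply/eqP => q0; have : q.[0] = 0 by rewrite q0 horner0.
  rewrite /q hornerD hornerN hornerM hornerX mul0r subr0 hornerC => /eqP.
  by rewrite oner_eq0.
have [rs qE] := closed_field_poly_normal q.
have [v Vv Mv] := invprod rs.
have l0 : lead_coef q != 0 by rewrite lead_coef_eq0.
apply: (subplace1 sM).
set t := (map_poly _ _).[x] in Mv.
have Mt : M t.
  have : M (kap (lead_coef q)^-1 * (map_poly kap q).[x]) by exact: Vk.
  rewrite {2}qE -mul_polyC rmorphM /= map_polyC hornerM hornerC mulrA.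
  by rewrite -rmorphM mulVf// rmorph1 mul1r.
by rewrite -(subrK (v * t) 1); apply: (subplaceD sM) => //; exact: Vv.
Qed.

(** * Adic completions *)

Section CompletionClass.
Variables (R : comPzRingType) (I : set R).
Implicit Types (u v : nat -> R) (x y : completion I).

(** Made total by the value 0 off Cauchy sequences, so that limits are written for bare sequences
    and the Cauchy condition is a side condition. *)
Definition compl_class u : completion I :=
  if pselect (adic_cauchy I u) is left uC then compl_pi (Cauchy (asboolT uC))
  else 0.

Lemma compl_pi0 : compl_pi 0 = 0 :> completion I.
Proof. by apply: (addrI (compl_pi 0)); rewrite -compl_piD !addr0. Qed.

Lemma compl_classE (u : cauchy I) : compl_class u = compl_pi u.
Proof.
rewrite /compl_class; case: pselect => [uC|[]]; last first.
  by case: u => u /= /asboolP.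
by congr compl_pi; apply: val_inj.
Qed.

Lemma cauchyP (u : cauchy I) : adic_cauchy I u.
Proof. by case: u => u /= /asboolP. Qed.

Lemma compl_class_surj x : exists2 u, adic_cauchy I u & compl_class u = x.
Proof.
exists (compl_repr x); first exact: cauchyP.
by rewrite compl_classE compl_reprK.
Qed.

Lemma adic_cauchyD u v : adic_cauchy I u -> adic_cauchy I v ->
  adic_cauchy I (fun i => u i + v i).
Proof.
move=> uC vC; have [_ _ H] := @cauchy_subring_closed R I.
pose a := Cauchy (asboolT uC); pose b := Cauchy (asboolT vC).
exact: (cauchyP (a + b)).
Qed.

Lemma adic_cauchyM u v : adic_cauchy I u -> adic_cauchy I v ->
  adic_cauchy I (fun i => u i * v i).
Proof.
move=> uC vC; pose a := Cauchy (asboolT uC); pose b := Cauchy (asboolT vC).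
exact: (cauchyP (a * b)).
Qed.

Lemma adic_cauchyN u : adic_cauchy I u -> adic_cauchy I (fun i => - u i).
Proof.
by move=> uC; pose a := Cauchy (asboolT uC); exact: (cauchyP (- a)).
Qed.

Lemma adic_cauchy_cst c : adic_cauchy I (fun=> c).
Proof.
move=> n; exists 0%N => i j _ _; rewrite subrr.
exact: (ideal0 (ideal_exp_ideal _ _)).
Qed.

Lemma compl_class0P u : adic_cauchy I u -> compl_class u = 0 <-> adic_null I u.
Proof.
move=> uC; pose a : cauchy I := Cauchy (asboolT uC).
rewrite -[u]/(a : nat -> R) compl_classE -compl_pi0.
split=> [/compl_eqP|H]; first by rewrite subr0 => /asboolP.
by apply/compl_eqP; rewrite subr0; apply/asboolP.
Qed.

Lemma compl_classD u v : adic_cauchy I u -> adic_cauchy I v ->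
  compl_class (fun i => u i + v i) = compl_class u + compl_class v.
Proof.
move=> uC vC; pose a := Cauchy (asboolT uC); pose b := Cauchy (asboolT vC).
rewrite -[u]/(a : nat -> R) -[v]/(b : nat -> R) !compl_classE -compl_piD.
exact: (compl_classE (a + b)).
Qed.

Lemma compl_classM u v : adic_cauchy I u -> adic_cauchy I v ->
  compl_class (fun i => u i * v i) = compl_class u * compl_class v.
Proof.
move=> uC vC; pose a := Cauchy (asboolT uC); pose b := Cauchy (asboolT vC).
rewrite -[u]/(a : nat -> R) -[v]/(b : nat -> R) !compl_classE.
rewrite [RHS]/GRing.mul /= -compl_piM.
exact: (compl_classE (a * b)).
Qed.

Lemma compl_classN u : adic_cauchy I u ->
  compl_class (fun i => - u i) = - compl_class u.
Proof.
move=> uC; apply: (addrI (compl_class u)); rewrite subrr.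
rewrite -compl_classD//; last exact: adic_cauchyN.
apply/compl_class0P; first by apply: adic_cauchyD => //; exact: adic_cauchyN.
by move=> n; exists 0%N => i _; rewrite subrr;
  exact: (ideal0 (ideal_exp_ideal _ _)).
Qed.

Lemma compl_class_eqP u v : adic_cauchy I u -> adic_cauchy I v ->
  compl_class u = compl_class v <-> adic_null I (fun i => u i - v i).
Proof.
move=> uC vC; have vNC := adic_cauchyN vC.
have dC := adic_cauchyD uC vNC.
rewrite -(compl_class0P dC) compl_classD// compl_classN//.
by split=> [->|/subr0_eq//]; rewrite subrr.
Qed.

Definition compl_cst (c : R) : completion I := compl_class (fun=> c).

Lemma compl_cst_zmod : zmod_morphism compl_cst.
Proof.
move=> a b; rewrite /compl_cst -compl_classN; last exact: adic_cauchy_cst.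
by rewrite -compl_classD//; exact: adic_cauchy_cst.
Qed.

Lemma compl_cst_monoid : monoid_morphism compl_cst.
Proof.
split; first exact: (compl_classE 1).
by move=> a b; rewrite -compl_classM//; exact: adic_cauchy_cst.
Qed.

HB.instance Definition _ := GRing.isZmodMorphism.Build R (completion I)
  compl_cst compl_cst_zmod.
HB.instance Definition _ := GRing.isMonoidMorphism.Build R (completion I)
  compl_cst compl_cst_monoid.

(* The closure of the image of [I ^ N], not a power of an ideal a priori. *)
Definition closed_pow N : set (completion I) := [set x | exists u,
  [/\ adic_cauchy I u, compl_class u = x &
      exists L, forall i, (L <= i)%N -> ideal_exp I N (u i)]].

Lemma closed_powP N u : adic_cauchy I u -> closed_pow N (compl_class u) <->
  exists L, forall i, (L <= i)%N -> ideal_exp I N (u i).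
Proof.
move=> uC; split=> [[v [vC /(compl_class_eqP vC uC) vu [L vL]]]|[L uL]];
  last first.
  by exists u; split=> //; exists L.
have [L' vu'] := vu N; exists (maxn L L') => i; rewrite geq_max => /andP[Li L'i].
rewrite -(subKr (v i) (u i)); apply: is_idealB; first exact: ideal_exp_ideal.
  exact: vL.
exact: vu'.
Qed.

Lemma closed_pow_ideal N : is_ideal (closed_pow N).
Proof.
have NI := ideal_exp_ideal I N; split.
- exists (fun=> 0); split; first exact: adic_cauchy_cst.
    exact: (rmorph0 compl_cst).
  by exists 0%N => i _; exact: (ideal0 NI).
- move=> _ _ [u [uC <- [L uL]]] [v [vC <- [L' vL]]].
  rewrite -compl_classD//; apply/closed_powP; first exact: adic_cauchyD.
  exists (maxn L L') => i; rewrite geq_max => /andP[Li L'i].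
  by apply: (idealD NI); [exact: uL|exact: vL].
- move=> a _ [v [vC <- [L vL]]]; have [u uC <-] := compl_class_surj a.
  rewrite -compl_classM//; apply/closed_powP; first exact: adic_cauchyM.
  by exists L => i Li; apply: (ideal_mull _ NI); exact: vL.
Qed.

Lemma closed_pow_sub N N' : (N <= N')%N -> closed_pow N' `<=` closed_pow N.
Proof.
move=> NN' _ [u [uC <- [L uL]]]; apply/closed_powP => //.
by exists L => i /uL; exact: ideal_exp_sub.
Qed.

Lemma closed_pow_cst N a : ideal_exp I N a -> closed_pow N (compl_cst a).
Proof.
move=> Ia; apply/closed_powP; first exact: adic_cauchy_cst.
by exists 0%N.
Qed.

Lemma compl_class_approx u N : adic_cauchy I u -> exists L, forall i,
  (L <= i)%N -> closed_pow N (compl_class u - compl_cst (u i)).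
Proof.
move=> uC; have [L uL] := uC N; exists L => i Li.
rewrite -compl_classN; last exact: adic_cauchy_cst.
have cC : adic_cauchy I (fun=> - u i) by exact: adic_cauchy_cst.
rewrite -compl_classD//; apply/closed_powP; first exact: adic_cauchyD.
by exists L => j Lj; exact: uL.
Qed.

Lemma ideal_mul_gen_cons g (s : seq R) (J : set R) (x : R) : is_ideal J ->
  ideal_mul (ideal_gen [set` g :: s]) J x ->
  exists z y : R, [/\ J z, ideal_mul (ideal_gen [set` s]) J y & x = g * z + y].
Proof.
move=> JI; apply: (@ideal_mul_min _ _ _ [set x : R | exists z y : R,
  [/\ J z, ideal_mul (ideal_gen [set` s]) J y & x = g * z + y]]).
  have mI := ideal_mul_ideal (ideal_gen [set` s]) J; split.
  - exists 0, 0; split; [exact: (ideal0 JI)|exact: (ideal0 mI)|ring].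
  - move=> _ _ [z [y [Jz my ->]]] [z' [y' [Jz' my' ->]]].
    exists (z + z'), (y + y'); split;
      [exact: (idealD JI)|exact: (idealD mI)|ring].
  - move=> a _ [z [y [Jz my ->]]]; exists (a * z), (a * y).
    by split; [exact: (ideal_mull _ JI)|exact: (ideal_mull _ mI)|ring].
move=> _ z /ideal_gen_cons[c [y [sy ->]]] Jz; exists (c * z), (y * z).
by split; [exact: (ideal_mull _ JI)|exact: ideal_mulP|ring].
Qed.

Lemma adic_cauchy_series N (w : nat -> R) :
  (forall l, ideal_exp I (N + l) (w l)) ->
  adic_cauchy I (fun l => \sum_(j < l) w j) /\
  closed_pow N (compl_class (fun l => \sum_(j < l) w j)).
Proof.
move=> wI.
have le_sum n i d : (n <= i)%N ->
    ideal_exp I n (\sum_(j < i + d) w j - \sum_(j < i) w j).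
  have nI := ideal_exp_ideal I n.
  move=> ni; elim: d => [|d IH]; first by rewrite addn0 subrr; exact: (ideal0 nI).
  rewrite addnS big_ord_recr /= addrAC; apply: (idealD nI) => //.
  apply: ideal_exp_sub (wI _); rewrite addnCA; apply: leq_trans ni _.
  exact: leq_addr.
have C : adic_cauchy I (fun l => \sum_(j < l) w j).
  move=> n; exists n => i j ni nj; wlog ij : i j ni nj / (i <= j)%N => [wl|].
    have [/wl|/ltnW/wl] := leqP i j; first exact.
    move=> /(_ nj ni)/(is_idealN (ideal_exp_ideal I n)); by rewrite opprB.
  rewrite -opprB; apply: is_idealN; first exact: ideal_exp_ideal.
  by rewrite -(subnKC ij); exact: le_sum.
split=> //; apply/closed_powP => //; exists 0%N => i _.
apply: (@ideal_sum _ _ _ (index_enum 'I_i) (fun j => w j));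
  first exact: ideal_exp_ideal.
by move=> j; apply: ideal_exp_sub (wI _); exact: leq_addr.
Qed.

(** One generator [g] is split off all terms at once: [w l = g * z l + w' l] with [z l] in
    [I ^ (N + l)]. The series of the [z l] converges inside [closed_pow N], so [g] factors out of
    the limit. *)
Lemma closed_pow_series (s : seq R) N (w : nat -> R) :
  (forall g, g \in s -> I g) ->
  (forall l, ideal_mul (ideal_gen [set` s]) (ideal_exp I (N + l)) (w l)) ->
  ideal_mul (closed_pow 1) (closed_pow N) (compl_class (fun l =>
    \sum_(j < l) w j)).
Proof.
elim: s w => [|g s IH] w sI wI.
  have w0 l : w l = 0.
    apply/ideal_gen_nil; apply: (@ideal_mul_min _ _ _ _ (ideal_gen_ideal _))
      (wI l).
    by move=> x y sx _; exact: (ideal_mulr _ (ideal_gen_ideal _)).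
  rewrite (_ : compl_class _ = 0).
    exact: (ideal0 (ideal_mul_ideal _ _)).
  rewrite -(rmorph0 compl_cst); congr compl_class; apply/funext => l.
  by rewrite big1.
have [z zP] := choice (fun l => ideal_mul_gen_cons (ideal_exp_ideal _ _) (wI l)).
have [w' w'P] := choice zP.
have [zC zN] := @adic_cauchy_series N z (fun l => let: And3 H _ _ := w'P l in H).
have w'I l : ideal_exp I (N + l) (w' l).
  have [_ + _] := w'P l; apply: ideal_mul_subr; exact: ideal_exp_ideal.
have [w'C _] := adic_cauchy_series w'I.
have gC := @adic_cauchy_cst g.
rewrite (_ : (fun l => \sum_(j < l) w j) =
  (fun l => (fun l => g * \sum_(j < l) z j) l + \sum_(j < l) w' j)); last first.
  apply/funext => l; rewrite mulr_sumr -big_split /=; apply: eq_bigr => j _.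
  by case: (w'P j).
rewrite compl_classD//; last exact: (adic_cauchyM gC zC).
rewrite (compl_classM gC zC); apply: (idealD (ideal_mul_ideal _ _)).
  apply: ideal_mulP => //; apply: closed_pow_cst.
  by rewrite -[g]mulr1; apply: ideal_mulP => //; apply: sI; rewrite mem_head.
apply: IH => [p ps|l]; first by apply: sI; rewrite inE ps orbT.
by case: (w'P l).
Qed.

Lemma closed_powS (s : seq R) N : I = ideal_gen [set` s] ->
  closed_pow N.+1 `<=` ideal_mul (closed_pow 1) (closed_pow N).
Proof.
move=> Es _ [u [uC <- [L0 uL0]]].
have [L LP] := choice (fun l => uC (N.+1 + l)%N).
(* A subsequence of [u] whose consecutive differences lie in [I ^ (N.+1 + l)]. The initial 0 makes
   it a telescoping series; [L0] puts its first term in [I ^ N.+1]. *)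
pose v l := if l is 0 then 0 else u (maxn L0 (L l)).
have vu l i : (0 < l)%N -> (L l <= i)%N -> ideal_exp I (N.+1 + l) (v l - u i).
  by case: l => // l _ Li; apply: LP => //; exact: leq_maxr.
have vS l : ideal_exp I (N.+1 + l) (v l.+1 - v l).
  have nI := ideal_exp_ideal I (N.+1 + l).
  case: l nI => [|l] nI.
    by rewrite /= subr0 addn0; apply: uL0; exact: leq_maxl.
  pose i := maxn (L l.+2) (L l.+1).
  rewrite -(subrKA (u i)); apply: (idealD nI).
    apply: (@ideal_exp_sub _ _ _ (N.+1 + l.+2)); first by rewrite leq_add2l.
    by apply: (vu l.+2) => //; exact: leq_maxl.
  rewrite -opprB; apply: (is_idealN nI).
  by apply: (vu l.+1) => //; exact: leq_maxr.
have vE l : v l = \sum_(j < l) (v j.+1 - v j).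
  elim: l => [|l IH]; first by rewrite big_ord0.
  by rewrite big_ord_recr /= -IH addrC subrK.
have vS' l : ideal_exp I (N + l) (v l.+1 - v l).
  by apply: (@ideal_exp_sub _ _ _ (N.+1 + l)) => //; rewrite addSn.
have [vC _] := adic_cauchy_series vS'.
rewrite (_ : compl_class u = compl_class (fun l => \sum_(j < l) (v j.+1 - v j))).
  apply: (@closed_pow_series s N (fun j => v j.+1 - v j)) => [g gs|l];
    first by rewrite Es; exact: sub_ideal_gen.
  rewrite -Es; exact: vS.
apply/(compl_class_eqP uC vC) => n.
have nI := ideal_exp_ideal I n.
exists (maxn n.+1 (L n)) => i; rewrite geq_max -vE => /andP[ni Li].
pose j := maxn (L i) (L n).
rewrite -(subrKA (u j)); apply: (idealD nI).
  apply: (@ideal_exp_sub _ _ _ (N.+1 + n)); first exact: leq_addl.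
  by apply: LP => //; exact: leq_maxr.
rewrite -opprB; apply: (is_idealN nI).
apply: (@ideal_exp_sub _ _ _ (N.+1 + i)).
  by rewrite (leq_trans (ltnW ni))// leq_addl.
by apply: vu; [exact: leq_ltn_trans ni|exact: leq_maxl].
Qed.

Lemma closed_pow_exp (s : seq R) N : I = ideal_gen [set` s] ->
  closed_pow N `<=` ideal_exp (closed_pow 1) N.
Proof.
move=> Es; elim: N => [//|N IH] x /(closed_powS Es).
apply: ideal_mul_min => [|y z Iy /IH]; first exact: ideal_mul_ideal.
exact: ideal_mulP.
Qed.

End CompletionClass.

(** * Places of completed local rings *)

Section CompletionLocal.
Variables (R : comPzRingType) (m : set R).
Hypothesis noethR : noetherian R.
Hypothesis localR : local_ring m.

Lemma local_ring_ideal : is_ideal m. Proof. by case: localR => -[]. Qed.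
Lemma local_ring_proper : ~ m 1. Proof. by case: localR => -[]. Qed.
Let mI := local_ring_ideal.
Let m1 := local_ring_proper.

Lemma local_ring_unit x : ~ m x -> exists y, y * x = 1.
Proof.
move=> nmx; apply: contrapT => nux.
have TI : is_ideal [set 0 : R].
  by split=> // [a b -> ->|a b ->]; rewrite /= ?addr0 ?mulr0.
have xI := principal_add_ideal x TI.
pose F := [set J | [/\ is_ideal J, ~ J 1 & J x]].
have [||J [JI J1 Jx] Jmax] :=
  @noetherian_max _ noethR F (principal_add x [set 0]).
- split=> //; last exact: principal_add_gen.
  by move=> [y [_ [-> E]]]; apply: nux; exists y; rewrite E addr0.
- by move=> J [].
apply: nmx; case: localR => _ /(_ J) <- //.
split=> // J' J'I JJ'; have [J'1|nJ'1] := pselect (J' 1); last first.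
  by left; apply/seteqP; split=> //; apply: Jmax => //; split=> //; exact: JJ'.
right; apply/seteqP; split=> // y _; rewrite -[y]mulr1; exact: (ideal_mull _ J'I).
Qed.

Lemma closed_pow_proper : ~ closed_pow (I:=m) 1 1.
Proof.
have -> : 1 = compl_cst m 1 by rewrite rmorph1.
move=> /closed_powP[]; first exact: adic_cauchy_cst.
by move=> L /(_ L (leqnn _)); rewrite ideal_exp1.
Qed.

(** The terms of a representing sequence are eventually units, and their inverses again form a
    Cauchy sequence. *)
Lemma closed_pow_unit (x : completion m) :
  ~ closed_pow (I:=m) 1 x -> exists y, y * x = 1.
Proof.
have [u uC <-] := compl_class_surj x => nx.
have [L uL] := uC 1%N; rewrite ideal_exp1// in uL.
have nu i : (L <= i)%N -> ~ m (u i).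
  move=> Li mu; apply: nx; apply/closed_powP => //; exists L => j Lj.
  rewrite ideal_exp1// -(subrK (u i) (u j)); apply: (idealD mI) => //.
  exact: uL.
have [f fP] : exists f : R -> R, forall a, ~ m a -> f a * a = 1.
  have H (a : R) : exists b, ~ m a -> b * a = 1.
    have [ma|/local_ring_unit[b ba]] := pselect (m a); first by exists 0.
    by exists b.
  have [f fP] := choice H; by exists f.
have fC : adic_cauchy m (fun i => f (u i)).
  move=> n; have [N uN] := uC n; exists (maxn N L) => i j.
  rewrite !geq_max => /andP[Ni Li] /andP[Nj Lj].
  have := fP _ (nu _ Li); have := fP _ (nu _ Lj); move: (uN _ _ Nj Ni).
  set a := u i; set b := u j => ba fb fa.
  rewrite (_ : _ - _ = f a * f b * (b - a)).
    exact: (ideal_mull _ (ideal_exp_ideal _ _)).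
  by rewrite mulrBr -mulrA fb mulrAC fa mulr1 mul1r.
exists (compl_class m (fun i => f (u i))).
rewrite -compl_classM// -[RHS](rmorph1 (@compl_cst _ m)).
apply/compl_class_eqP; [exact: adic_cauchyM|exact: adic_cauchy_cst|].
move=> n; exists L => i Li; rewrite fP ?subrr; last exact: nu.
exact: (ideal0 (ideal_exp_ideal _ _)).
Qed.

Lemma exists_coheight_one_point (x : completion m) :
  noetherian (completion m) -> is_domain (completion m) -> x != 0 ->
  exists (K : fieldType) (phi : {rmorphism completion m -> K}),
  [/\ phi x != 0, forall u, closed_pow 1 u -> phi u <> 1 &
    forall a, phi a != 0 -> exists N, forall y, closed_pow N y ->
      exists2 u, closed_pow 1 u & phi y = phi a * phi u].
Proof.
move=> noethC [C1 Cdom] x0.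
have xn n : x ^+ n != 0.
  elim: n => [//|n IH]; rewrite exprS; apply/eqP => /Cdom.
  by rewrite (negbTE x0) (negbTE IH).
have [s Es] := noethR mI.
have cI := closed_pow_ideal m 1.
have [P [Ppr nPx Pht]] :=
  coheight_one_prime noethC cI closed_pow_proper closed_pow_unit xn.
have [K [phi phiP]] := prime_residue_field Ppr.
have [PI P1 _] := Ppr.
exists K, phi; split.
- by apply/eqP => /phiP.
- move=> u mu u1; apply: P1.
  have [v vE] := unit_1sub cI closed_pow_proper closed_pow_unit mu.
  by rewrite -vE; apply: (ideal_mull _ PI); apply/phiP;
    rewrite rmorphB u1 rmorph1 subrr.
move=> a /eqP a0; have [|N NP] := Pht a; first by move=> /phiP.
(* The power beyond [N] supplies the factor [u] in [closed_pow 1]: [phi y] must later have value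
   strictly above that of [phi a]. *)
exists N.+1 => y /(closed_powS Es) my.
have {my} : exists u, closed_pow 1 u /\ P (y - a * u).
  move: y my; apply: (@ideal_mul_min _ _ _
    [set y | exists u, closed_pow 1 u /\ P (y - a * u)]).
    split.
    - by exists 0; split; [exact: (ideal0 cI)|rewrite mulr0 subrr;
      exact: (ideal0 PI)].
    - move=> y z [u [mu Pu]] [v [mv Pv]]; exists (u + v).
      split; first exact: (idealD cI).
      by rewrite mulrDr opprD addrACA; exact: (idealD PI).
    - move=> b y [u [mu Pu]]; exists (b * u); split;
      first exact: (ideal_mull _ cI).
      by rewrite mulrCA -mulrBr; exact: (ideal_mull _ PI).
  move=> u w mu /(closed_pow_exp Es)/NP[c [p [Pp ->]]].
  exists (u * c); split; first exact: (ideal_mulr _ cI).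
  by rewrite (_ : _ - _ = u * p); [exact: (ideal_mull _ PI)|ring].
move=> [u [mu /phiP]]; rewrite rmorphB rmorphM => /subr0_eq E.
by exists u.
Qed.

End CompletionLocal.

(** * Continuous valuations on completions *)

Section TamePlace.
Variables (R : comPzRingType) (m : set R).
Variables (K : fieldType) (phi : {rmorphism completion m -> K}).
Implicit Types M : set K.

(** The second clause is continuity: the elements of value larger than that of [phi a] include a
    neighbourhood of 0. Outside [closed_pow 1], values may be negative. *)
Definition tame_place M :=
  (forall x, closed_pow 1 x -> M (phi x)) /\
  forall a, phi a != 0 -> exists N, forall y, closed_pow N y ->
    exists2 t, M t & phi y = phi a * t.

(** [S0] accommodates both sides: the scalars of [k] for [A], the whole image of the completion for
    [B]. In either case the image of [closed_pow 1] is a subplace to start from. *)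
Lemma exists_tame_place (S0 : set K) : (forall s, S0 s -> exists a, phi a = s) ->
  (forall u, closed_pow 1 u -> phi u <> 1) ->
  (forall a, phi a != 0 -> exists N, forall y, closed_pow N y ->
      exists2 u, closed_pow 1 u & phi y = phi a * phi u) ->
  exists2 M, place S0 M & tame_place M.
Proof.
move=> S0P phi1 phiN; have cI := closed_pow_ideal m 1.
have [|M pM IM] := @exists_place K S0 (phi @` closed_pow (I:=m) 1).
  split.
  - by exists 0; [exact: (ideal0 cI)|rewrite rmorph0].
  - move=> _ _ [x cx <-] [y cy <-]; exists (x + y); last by rewrite rmorphD.
    exact: (idealD cI).
  - by move=> _ [x cx <-]; exists (- x); [exact: (is_idealN cI)|rewrite rmorphN].
  - move=> _ _ [x cx <-] [y cy <-]; exists (x * y); last by rewrite rmorphM.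
    exact: (ideal_mull _ cI).
  - move=> _ _ /S0P[s <-] [x cx <-]; exists (s * x); last by rewrite rmorphM.
    exact: (ideal_mull _ cI).
  - by move=> [x /phi1].
exists M => //; split=> [x cx|a /phiN[N NP]]; first by apply: IM; exists x.
by exists N => y /NP[u cu ->]; exists (phi u) => //; apply: IM; exists u.
Qed.

Definition base_restr : R -> K := fun a => phi (compl_cst m a).
HB.instance Definition _ := GRing.RMorphism.copy base_restr
  ([the {rmorphism _ -> _} of phi] \o [the {rmorphism _ -> _} of @compl_cst R m]).

(** The topology of the image of [phi], pulled back to [R]. These sets are ideals even if [R] is not
    mapped into the valuation ring, when the sets of elements of large value need not be. *)
Definition kernel_nbhs N : set R :=
  [set a | exists2 y, closed_pow N y & base_restr a = phi y].

Lemma kernel_nbhs_ideal N : is_ideal (kernel_nbhs N).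
Proof.
have cI := closed_pow_ideal m N; split.
- by exists 0; [exact: (ideal0 cI)|rewrite !rmorph0].
- move=> a b [y cy ay] [z cz bz]; exists (y + z); first exact: (idealD cI).
  by rewrite !rmorphD; congr (_ + _).
- move=> a b [y cy ay]; exists (compl_cst m a * y);
  first exact: (ideal_mull _ cI).
  by rewrite !rmorphM; congr (_ * _).
Qed.

Lemma kernel_nbhs_sub N N' : (N <= N')%N -> kernel_nbhs N' `<=` kernel_nbhs N.
Proof. by move=> NN' a [y /(closed_pow_sub NN') cy E]; exists y. Qed.

Lemma ideal_exp_kernel_nbhs N : ideal_exp m N `<=` kernel_nbhs N.
Proof. by move=> a ma; exists (compl_cst m a) => //; exact: closed_pow_cst. Qed.

Lemma class_neq0 (u : nat -> R) N : adic_cauchy m u ->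
  (forall L, exists2 l, (L <= l)%N & ~ kernel_nbhs N (u l)) ->
  phi (compl_class m u) != 0.
Proof.
move=> uC uN; apply/eqP => u0.
have [L LP] := compl_class_approx N uC.
have [l /LP cl] := uN L; apply.
exists (- (compl_class m u - compl_cst m (u l))).
  by apply: is_idealN => //; exact: closed_pow_ideal.
by rewrite opprB rmorphB u0 subr0.
Qed.

Variables (S0 M : set K).
Hypothesis placeM : place S0 M.
Hypothesis tameM : tame_place M.
Let sM : subplace S0 M := placeM.1.

(** The distance from [u l] to its nonzero limit is eventually of larger value than the limit. Hence
    [u l] and the limit share not only their value but also their leading coefficient. *)
Lemma class_value (u : nat -> R) : adic_cauchy m u ->
  phi (compl_class m u) != 0 ->
  exists L, forall l, (L <= l)%N ->
    exists2 t, M t & base_restr (u l) = phi (compl_class m u) * (1 + t).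
Proof.
move=> uC u0; have [N NP] := tameM.2 _ u0.
have [L LP] := compl_class_approx N uC.
exists L => l /LP/NP[t Mt E]; exists (- t); first exact: (subplaceN sM).
rewrite mulrBr mulr1 -E rmorphB; rewrite /base_restr; ring.
Qed.

Lemma class_away (u : nat -> R) : adic_cauchy m u -> phi (compl_class m u) != 0 ->
  exists N L, forall l, (L <= l)%N -> ~ kernel_nbhs N (u l).
Proof.
move=> uC u0; have [L LP] := class_value uC u0; have [N NP] := tameM.2 _ u0.
exists N, L => l /LP[t Mt E] [y /NP[t' Mt' E'] Ey].
apply: (subplace1 sM); suff -> : 1 = t' - t.
  by apply: (subplaceD sM) => //; exact: (subplaceN sM).
by apply: (mulfI u0); rewrite mulrBr mulr1 -E' -Ey E; ring.
Qed.

End TamePlace.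

(** * Tensor products of vector spaces *)

Section Functionals.
Variables (k : fieldType) (V : lmodType k).
Implicit Types (Q : set V) (x y : V).

Definition subspace Q :=
  [/\ Q 0, forall x y, Q x -> Q y -> Q (x + y) & forall c x, Q x -> Q (c *: x)].

Lemma subspaceN Q x : subspace Q -> Q x -> Q (- x).
Proof. by case=> _ _ QZ Qx; rewrite -scaleN1r; exact: QZ. Qed.

Lemma subspaceB Q x y : subspace Q -> Q x -> Q y -> Q (x - y).
Proof. by move=> sQ Qx Qy; case: (sQ) => _ QD _; apply: QD => //;
  exact: subspaceN. Qed.

Definition functional (f : V -> k) :=
  (forall x y, f (x + y) = f x + f y) /\ (forall c x, f (c *: x) = c * f x).

(** A subspace maximal among those containing [Q] and missing [x0] is a complement of the line of
    [x0]; [f] reads off the coordinate on that line. *)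
Lemma exists_functional Q x0 : subspace Q -> ~ Q x0 ->
  exists f, [/\ functional f, forall x, Q x -> f x = 0 & f x0 = 1].
Proof.
move=> sQ nQx0.
pose P : set (set V) := [set X | X = set0 \/ [/\ subspace X, Q `<=` X & ~ X x0]].
have Q0 : Q 0 by case: sQ.
have [|H [[H0|[sH QH nHx0]] Hmax]] := @Zorn_bigcup V P.
- move=> C CP Ctot.
  have [[X [CX [sX QX nX]]]|noX] :=
      pselect (exists X, C X /\ [/\ subspace X, Q `<=` X & ~ X x0]); last first.
    left; apply/seteqP; split=> // x [X CX Xx]; have [X0|HX] := CP _ CX.
      by rewrite X0 in Xx.
    by case: noX; exists X.
  right; split.
  + split.
    * by exists X => //; case: sX.
    * move=> x y [Y CY Yx] [Z CZ Zy]; have [YZ|ZY] := Ctot _ _ CY CZ.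
        exists Z => //; have [Z0|[[_ ZD _] _ _]] := CP _ CZ;
          first by rewrite Z0 in Zy.
        by apply: ZD => //; exact: YZ.
      exists Y => //; have [Y0|[[_ YD _] _ _]] := CP _ CY;
        first by rewrite Y0 in Yx.
      by apply: YD => //; exact: ZY.
    * move=> c x [Y CY Yx]; exists Y => //.
      have [Y0|[[_ _ YZ] _ _]] := CP _ CY; first by rewrite Y0 in Yx.
      exact: YZ.
  + by move=> x Qx; exists X => //; exact: QX.
  + by move=> [Y /CP[->//|[_ _ nY]]].
- have [] := Hmax Q; last by right; split.
  by rewrite H0; split=> // /(_ _ Q0).
have [Hz HD HZ] := sH.
have decomp x : exists c, H (x - c *: x0).
  apply: contrapT => nc.
  pose H' := [set z | exists h c, H h /\ z = h + c *: x].
  have nHx : ~ H x by move=> Hx; apply: nc; exists 0; rewrite scale0r subr0.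
  have H'x0 : H' x0.
    apply: contrapT => nH'; have [] := Hmax H'.
      split; first by move=> h Hh; exists h, 0; rewrite scale0r addr0.
      by move=> /(_ x) Hx; apply/nHx/Hx; exists 0, 1; rewrite scale1r add0r.
    right; split=> //; last by move=> h /QH Hh; exists h, 0;
      rewrite scale0r addr0.
    split.
    - by exists 0, 0; rewrite scale0r addr0.
    - move=> _ _ [h [c [Hh ->]]] [h' [c' [Hh' ->]]]; exists (h + h'), (c + c').
      by split; [exact: HD|rewrite scalerDl addrACA].
    - move=> d _ [h [c [Hh ->]]]; exists (d *: h), (d * c).
      by split; [exact: HZ|rewrite scalerDr scalerA].
  have [h [c [Hh E]]] := H'x0.
  have c0 : c != 0.
    by apply/eqP => c0; apply: nHx0; rewrite E c0 scale0r addr0.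
  apply: nc; exists c^-1; rewrite E scalerDr scalerA mulVf// scale1r.
  by rewrite opprD addrCA subrr addr0; apply: subspaceN => //; exact: HZ.
have [f fP] := choice decomp.
have funi x c : H (x - c *: x0) -> f x = c.
  move=> Hc; apply: contrapT => /eqP fc; apply: nHx0.
  have d0 : c - f x != 0 by rewrite subr_eq0 eq_sym.
  rewrite -[x0]scale1r -(mulVf d0) -scalerA; apply: HZ.
  rewrite (_ : _ *: x0 = (x - f x *: x0) - (x - c *: x0)); first exact: subspaceB.
  by rewrite scalerBl opprB [RHS]addrC subrKA.
exists f; split; [split|..].
- move=> x y; apply: funi; rewrite scalerDl opprD addrACA; exact: HD.
- by move=> c x; apply: funi; rewrite -scalerA -scalerBr; exact: HZ.
- by move=> x /QH Hx; apply: funi; rewrite scale0r subr0.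
- by apply: funi; rewrite scale1r subrr.
Qed.

End Functionals.

Lemma ideal_subspace (k : fieldType) (A : comAlgType k) (I : set A) :
  is_ideal I -> subspace I.
Proof.
move=> II; split; [exact: (ideal0 II)|by move=> x y; exact: (idealD II)|].
by move=> c x Ix; rewrite -mulr_algl; exact: (ideal_mull _ II).
Qed.

Section TensorSpan.
Variables (k : fieldType) (A B : comAlgType k).
Implicit Types (P : set A) (Q G : set B) (Z : A -> B -> Prop) (x y : tensor A B).

Lemma tens0l b : tens (0 : A) b = 0 :> tensor A B.
Proof. by apply: (addrI (tens 0 b)); rewrite -tensDl !addr0. Qed.

Lemma tens0r a : tens a (0 : B) = 0 :> tensor A B.
Proof. by apply: (addrI (tens a 0)); rewrite -tensDr !addr0. Qed.

Lemma tensNl (a : A) (b : B) : tens (- a) b = - tens a b.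
Proof. by apply: (addrI (tens a b)); rewrite -tensDl !subrr tens0l. Qed.

Lemma tens_sumr (T : Type) (r : seq T) (a : A) (F : T -> B) :
  tens a (\sum_(i <- r) F i) = \sum_(i <- r) tens a (F i).
Proof.
elim: r => [|i r IH]; first by rewrite !big_nil tens0r.
by rewrite !big_cons tensDr IH.
Qed.

Definition tens_sum (s : seq (A * B)) : tensor A B := \sum_(p <- s) tens p.1 p.2.

Lemma tens_sum_cons a b s : tens_sum ((a, b) :: s) = tens a b + tens_sum s.
Proof. by rewrite /tens_sum big_cons. Qed.

Definition tens_span Z : set (tensor A B) := [set x | exists2 s : seq (A * B),
  (forall p, p \in s -> Z p.1 p.2) & x = tens_sum s].

Lemma tens_span0 Z : tens_span Z 0.
Proof. by exists [::] => //; rewrite /tens_sum big_nil. Qed.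

Lemma tens_spanD Z x y : tens_span Z x -> tens_span Z y -> tens_span Z (x + y).
Proof.
move=> [s sZ ->] [t tZ ->]; exists (s ++ t); last by rewrite /tens_sum big_cat.
by move=> p; rewrite mem_cat => /orP[/sZ|/tZ].
Qed.

Lemma tens_span_gen Z a b : Z a b -> tens_span Z (tens a b).
Proof.
move=> Zab; exists [:: (a, b)]; last by rewrite /tens_sum big_seq1.
by move=> p; rewrite inE => /eqP->.
Qed.

Lemma tens_span_ind Z (H : set (tensor A B)) : H 0 ->
  (forall x y, H x -> H y -> H (x + y)) -> (forall a b, Z a b -> H (tens a b)) ->
  tens_span Z `<=` H.
Proof.
move=> H0 HD HZ _ [s sZ ->]; rewrite /tens_sum big_seq;
  elim/big_ind: _ => // p /sZ.
exact: HZ.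
Qed.

Lemma tens_span_mono Z Z' : (forall a b, Z a b -> Z' a b) ->
  tens_span Z `<=` tens_span Z'.
Proof. by move=> ZZ' x [s sZ ->]; exists s => // p /sZ/ZZ'. Qed.

Lemma tens_spanM Z Z' Z'' x y :
  (forall a b a' b', Z a b -> Z' a' b' -> Z'' (a * a') (b * b')) ->
  tens_span Z x -> tens_span Z' y -> tens_span Z'' (x * y).
Proof.
move=> ZZ' Zx Z'y; move: x Zx; apply: tens_span_ind => [|x x' Hx Hx'|a b Zab].
- by rewrite mul0r; exact: tens_span0.
- by rewrite mulrDl; exact: tens_spanD.
move: y Z'y; apply: tens_span_ind => [|y y' Hy Hy'|a' b' Z'ab].
- by rewrite mulr0; exact: tens_span0.
- by rewrite mulrDr; exact: tens_spanD.
- by rewrite -tensM; apply: tens_span_gen; exact: ZZ'.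
Qed.

Lemma tens_spanN Z x : (forall a b, Z a b -> Z (- a) b) ->
  tens_span Z x -> tens_span Z (- x).
Proof.
move=> ZN; move: x; apply: tens_span_ind => [|x x' Hx Hx'|a b Zab].
- by rewrite oppr0; exact: tens_span0.
- by rewrite opprD; exact: tens_spanD.
- by rewrite -tensNl; apply: tens_span_gen; exact: ZN.
Qed.

Lemma tens_spanT x : tens_span (fun _ _ => True) x.
Proof. by have [s ->] := tensor_sum x; exists s. Qed.

(* P (x) B + A (x) Q *)
Definition tens_nbhs P Q := tens_span (fun a b => P a \/ Q b).

Lemma tens_nbhs_mono P P' Q Q' : P `<=` P' -> Q `<=` Q' ->
  tens_nbhs P Q `<=` tens_nbhs P' Q'.
Proof.
by move=> PP' QQ'; apply: tens_span_mono => a b [/PP'|/QQ']; [left|right].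
Qed.

Lemma tens_nbhsB P Q x y : subspace P ->
  tens_nbhs P Q x -> tens_nbhs P Q y -> tens_nbhs P Q (x - y).
Proof.
move=> sP Px Py; apply: tens_spanD => //; apply: tens_spanN => // a b [Pa|];
  last by right.
by left; exact: subspaceN.
Qed.

Lemma contract_right (f : B -> k) : functional f ->
  exists F : {additive tensor A B -> A}, forall a b, F (tens a b) = f b *: a.
Proof.
move=> [fD fZ]; apply: tensor_lift => [a a' b|a b b'|c a b].
- by rewrite scalerDr.
- by rewrite fD scalerDl.
- by rewrite fZ scalerA mulrC.
Qed.

Lemma contract_nbhs (f : B -> k) (F : {additive tensor A B -> A}) P Q x :
  (forall a b, F (tens a b) = f b *: a) -> subspace P ->
  (forall b, Q b -> f b = 0) -> tens_nbhs P Q x -> P (F x).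
Proof.
move=> FE sP fQ; have [P0 PD PZ] := sP.
move: x; apply: tens_span_ind => [|x y Hx Hy|a b H].
- by rewrite raddf0.
- by rewrite raddfD; exact: PD.
- by rewrite FE; case: H => [|/fQ->]; [exact: PZ|rewrite scale0r].
Qed.

(* Either the sum of pure tensors [x] can be shortened modulo [P (x) B + A (x) Q],
   or its first right factor is independent, modulo [Q], of the other ones. *)
Lemma exists_contraction P Q x : subspace P -> subspace Q -> ~ tens_nbhs P Q x ->
  exists f (F : {additive tensor A B -> A}), [/\ functional f,
    forall a b, F (tens a b) = f b *: a, forall b, Q b -> f b = 0 & ~ P (F x)].
Proof.
move=> sP sQ; have [s ->] := tensor_sum x; rewrite -/(tens_sum s).
have [P0 PD PZ] := sP; have [Q0 QD QZ] := sQ.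
have [n] := ubnP (size s); elim: n s => // n IH [|[a b] s] /= sn.
  by rewrite /tens_sum big_nil; case; exact: tens_span0.
rewrite tens_sum_cons => ns.
have [Pa|nPa] := pselect (P a).
  have [|f [F [fl FE fQ nF]]] := IH s sn.
    by move=> Hs; apply: ns; apply: tens_spanD => //; apply: tens_span_gen; left.
  exists f, F; split=> // PF; apply: nF.
  rewrite -(addKr (F (tens a b)) (F (tens_sum s))) -raddfD addrC.
  by apply: subspaceB => //; rewrite FE; exact: PZ.
pose t i := nth (0, 0) s i; pose r := index_iota 0 (size s).
have sE : tens_sum s = \sum_(i <- r) tens (t i).1 (t i).2.
  by rewrite /tens_sum (big_nth (0, 0)).
pose H := [set y | exists q (c : nat -> k),
  Q q /\ y = q + \sum_(i <- r) c i *: (t i).2].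
have [[q [c [Qq bE]]]|nHb] := pselect (H b).
  pose s' := [seq ((t i).1 + c i *: a, (t i).2) | i <- r].
  have s'E : tens a b + tens_sum s = tens_sum s' + tens a q.
    rewrite bE tensDr tens_sumr [RHS]addrC -addrA; congr (_ + _).
    rewrite sE /tens_sum big_map -big_split; apply: eq_bigr => i _ /=.
    by rewrite tensDl tensZ addrC.
  have Qaq : tens_nbhs P Q (tens a q) by apply: tens_span_gen; right.
  have [||f [F [fl FE fQ nF]]] := IH s';
    first by rewrite size_map size_iota subn0.
    by move=> Hs; apply: ns; rewrite s'E; exact: tens_spanD.
  by exists f, F; split=> //;
    rewrite s'E raddfD [F (tens a q)]FE fQ// scale0r addr0.
have sH : subspace H.
  split.
  - by exists 0, (fun=> 0); split=> //; rewrite big1 ?addr0// => i _;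
    exact: scale0r.
  - move=> _ _ [q [c [Qq ->]]] [q' [c' [Qq' ->]]].
    exists (q + q'), (fun i => c i + c' i); split; first exact: QD.
    rewrite addrACA -big_split; congr (_ + _); apply: eq_bigr => i _.
    by rewrite scalerDl.
  - move=> d _ [q [c [Qq ->]]]; exists (d *: q), (fun i => d * c i).
    split; first exact: QZ.
    rewrite scalerDr scaler_sumr; congr (_ + _); apply: eq_bigr => i _.
    by rewrite scalerA.
have [f [fl fH fb]] := exists_functional sH nHb.
have [F FE] := contract_right fl.
have fQ q : Q q -> f q = 0.
  move=> Qq; apply: fH; exists q, (fun=> 0); split=> //.
  by rewrite big1 ?addr0// => i _; exact: scale0r.
exists f, F; split=> //.
suff Fs0 : F (tens_sum s) = 0 by rewrite raddfD FE fb scale1r Fs0 addr0.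
rewrite sE raddf_sum big_seq big1// => i ir.
suff ft : f (t i).2 = 0 by rewrite [LHS]FE ft scale0r.
apply: fH; exists 0, (fun j => (j == i)%:R); split=> //.
rewrite add0r (bigD1_seq i) ?iota_uniq//= eqxx scale1r big1 ?addr0// => j.
by move=> /negbTE ->; rewrite scale0r.
Qed.

End TensorSpan.

Section TensorSwap.
Variables (k : fieldType).

Lemma tens_swap (A B : comAlgType k) : exists S : {additive tensor A B ->
  tensor B A},
  forall a b, S (tens a b) = tens b a.
Proof.
apply: tensor_lift => [a a' b|a b b'|c a b]; [exact: tensDr|exact: tensDl|].
by rewrite tensZ.
Qed.

Lemma tens_swap_nbhs (A B : comAlgType k)
    (S : {additive tensor A B -> tensor B A}) (P : set A) (Q : set B) x :
  (forall a b, S (tens a b) = tens b a) ->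
  tens_nbhs P Q x -> tens_nbhs Q P (S x).
Proof.
move=> SE; move: x; apply: tens_span_ind => [|x y Hx Hy|a b H].
- by rewrite raddf0; exact: tens_span0.
- by rewrite raddfD; exact: tens_spanD.
- by rewrite SE; apply: tens_span_gen; case: H; [right|left].
Qed.

Lemma tens_swapK (A B : comAlgType k) (S : {additive tensor A B -> tensor B A})
    (S' : {additive tensor B A -> tensor A B}) x :
  (forall a b, S (tens a b) = tens b a) ->
  (forall b a, S' (tens b a) = tens a b) -> S' (S x) = x.
Proof.
move=> SE S'E; have := tens_spanT x; move: x.
apply: tens_span_ind => [|x y Hx Hy|a b _]; first by rewrite !raddf0.
  by rewrite !raddfD Hx Hy.
by rewrite SE S'E.
Qed.

End TensorSwap.

(** * The adic topology of the tensor product *)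

Section TensorAdic.
Variables (k : fieldType) (A B : comAlgType k) (m : set A) (n : set B).
Hypotheses (mI : is_ideal m) (nI : is_ideal n).
Local Notation T := (tensor A B).
Local Notation I := (tensor_ideal m n).

Definition adic_nbhs N : set T := tens_nbhs (ideal_exp m N) (ideal_exp n N).

Lemma tens_mul1 a b : tens a b = tens a 1 * tens 1 b :> T.
Proof. by rewrite -tensM mulr1 mul1r. Qed.

Lemma ideal_exp_tensl N a : ideal_exp m N a -> ideal_exp I N (tens a 1).
Proof.
have NI j := ideal_exp_ideal I j.
elim: N a => [//|N IH] a.
apply: (@ideal_mul_min _ _ _ [set a | ideal_exp I N.+1 (tens a 1)]).
  split=> [|x y Hx Hy|x y Hy] /=.
  - by rewrite tens0l; exact: (ideal0 (NI N.+1)).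
  - by rewrite tensDl; exact: (idealD (NI N.+1)).
  - by rewrite -[1]mulr1 tensM; exact: (ideal_mull _ (NI N.+1)).
move=> x y mx /IH Iy; rewrite /= -[1]mulr1 tensM; apply: ideal_mulP => //.
exists (tens x 1); first by apply: sub_ideal_gen; exists x.
by exists 0; [exact: (ideal0 (ideal_gen_ideal _))|rewrite addr0].
Qed.

Lemma ideal_exp_tensr N b : ideal_exp n N b -> ideal_exp I N (tens 1 b).
Proof.
have NI j := ideal_exp_ideal I j.
elim: N b => [//|N IH] b.
apply: (@ideal_mul_min _ _ _ [set b | ideal_exp I N.+1 (tens 1 b)]).
  split=> [|x y Hx Hy|x y Hy] /=.
  - by rewrite tens0r; exact: (ideal0 (NI N.+1)).
  - by rewrite tensDr; exact: (idealD (NI N.+1)).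
  - by rewrite -[1]mulr1 tensM; exact: (ideal_mull _ (NI N.+1)).
move=> x y nx /IH Iy; rewrite /= -[1]mulr1 tensM; apply: ideal_mulP => //.
exists 0; first exact: (ideal0 (ideal_gen_ideal _)).
by exists (tens 1 x); [apply: sub_ideal_gen; exists x|rewrite add0r].
Qed.

Lemma adic_nbhs_sub_exp N : adic_nbhs N `<=` ideal_exp I N.
Proof.
have NI := ideal_exp_ideal I N.
apply: tens_span_ind => [|x y|a b]; [exact: (ideal0 NI)|exact: (idealD NI)|].
rewrite tens_mul1 => -[/ideal_exp_tensl|/ideal_exp_tensr] H.
  exact: (ideal_mulr _ NI).
exact: (ideal_mull _ NI).
Qed.

Lemma exp_sub_bigraded j : ideal_exp I j `<=`
  tens_span (fun a b => exists p q, [/\ (j <= p + q)%N,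
    ideal_exp m p a & ideal_exp n q b]).
Proof.
pose Z j (a : A) (b : B) :=
  exists p q, [/\ (j <= p + q)%N, ideal_exp m p a & ideal_exp n q b].
have ZI i : is_ideal (tens_span (Z i)).
  split; [exact: tens_span0|by move=> x y; exact: tens_spanD|].
  move=> x y; apply: tens_spanM (tens_spanT x) => a b a' b' _ [p [q [ipq mp nq]]].
  exists p, q; split=> //.
    exact: (ideal_mull _ (ideal_exp_ideal _ _)).
  exact: (ideal_mull _ (ideal_exp_ideal _ _)).
elim: j => [|j IH] x.
  by move=> _; apply: tens_span_mono (tens_spanT x) => a b _; exists 0%N, 0%N.
have I1 : I `<=` tens_span (Z 1%N).
  move=> _ [y + [z + <-]] => gy gz; apply: (idealD (ZI 1%N)).
    move: y gy; apply: ideal_gen_min => // _ [a ma <-].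
    apply: tens_span_gen; exists 1%N, 0%N; split=> //; by rewrite ideal_exp1.
  move: z gz; apply: ideal_gen_min => // _ [b nb <-].
  apply: tens_span_gen; exists 0%N, 1%N; split=> //; by rewrite ideal_exp1.
apply: ideal_mul_min => [|y z /I1 y1 /IH]; first exact: ZI.
apply: tens_spanM y1 => a b a' b' [p [q [pq mp nq]]] [p' [q' [pq' mp' nq']]].
exists (p + p')%N, (q + q')%N; split; [|exact: ideal_expD|exact: ideal_expD].
by rewrite addnACA -add1n leq_add.
Qed.

(** If [p + q] is at least [N + N], then [p] or [q] is at least [N]. Thus [adic_nbhs], which
    contractions respect, is cofinal with the powers of the ideal. *)
Lemma exp_sub_adic_nbhs N : ideal_exp I (N + N) `<=` adic_nbhs N.
Proof.
move=> x /exp_sub_bigraded; apply: tens_span_mono => a b [p [q [Npq mp nq]]].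
have [Np|pN] := leqP N p; first by left; exact: (ideal_exp_sub Np).
right; have Nq : (N <= q)%N.
  by rewrite -(leq_add2l N); apply: leq_trans Npq _; rewrite leq_add2r ltnW.
exact: (ideal_exp_sub Nq).
Qed.

End TensorAdic.

(** * Contractions of Cauchy sequences *)

Definition tens_cauchy (k : fieldType) (A B : comAlgType k) (m : set A) (n :
  set B)
    (f : nat -> tensor A B) := forall N, exists L, forall i j,
  (L <= i)%N -> (L <= j)%N -> adic_nbhs m n N (f i - f j).

(** A functional found for a single index serves the whole tail, since later differences lie in
    [P (x) B + A (x) Q]. As it kills the open subspace [Q], its contraction preserves Cauchy
    sequences. *)
Lemma cauchy_contraction (k : fieldType) (A B : comAlgType k) (m : set A) (n :
  set B)
    (f : nat -> tensor A B) (N0 : nat) (P : set A) (Q : set B) :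
  tens_cauchy m n f -> subspace P -> subspace Q ->
  ideal_exp m N0 `<=` P -> ideal_exp n N0 `<=` Q ->
  (forall L, exists2 l, (L <= l)%N & ~ tens_nbhs P Q (f l)) ->
  exists (lam : B -> k) (F : {additive tensor A B -> A}),
  [/\ forall a b, F (tens a b) = lam b *: a,
      forall b, Q b -> lam b = 0,
      adic_cauchy m (fun l => F (f l)) &
      exists L, forall l, (L <= l)%N -> ~ P (F (f l))].
Proof.
move=> fC sP sQ mP nQ fPQ; have [L LP] := fC N0; have [l0 Ll0 nf] := fPQ L.
have [lam [F [laml FE lamQ nF]]] := exists_contraction sP sQ nf.
exists lam, F; split=> //.
  move=> N; have [L' L'P] := fC (maxn N N0); exists L' => i j Li Lj.
  rewrite -raddfB; apply: (contract_nbhs FE _ lamQ).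
    exact/ideal_subspace/ideal_exp_ideal.
  apply: tens_nbhs_mono (L'P _ _ Li Lj) => x.
    by apply: ideal_exp_sub; exact: leq_maxl.
  by move=> H; apply/nQ/(ideal_exp_sub _ H); exact: leq_maxr.
exists L => l Ll PF; apply: nF.
rewrite -(subKr (F (f l)) (F (f l0))); apply: subspaceB => //.
rewrite -raddfB; apply: (contract_nbhs FE _ lamQ) => //.
exact: (tens_nbhs_mono mP nQ (LP _ _ Ll Ll0)).
Qed.

Lemma cauchy_contraction_left (k : fieldType) (A B : comAlgType k)
    (m : set A) (n : set B)
    (f : nat -> tensor A B) (N0 : nat) (P : set A) (Q : set B) :
  tens_cauchy m n f -> subspace P -> subspace Q ->
  ideal_exp m N0 `<=` P -> ideal_exp n N0 `<=` Q ->
  (forall L, exists2 l, (L <= l)%N & ~ tens_nbhs P Q (f l)) ->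
  exists (lam : A -> k) (F : {additive tensor A B -> B}),
  [/\ forall a b, F (tens a b) = lam a *: b,
      forall a, P a -> lam a = 0,
      adic_cauchy n (fun l => F (f l)) &
      exists L, forall l, (L <= l)%N -> ~ Q (F (f l))].
Proof.
move=> fC sP sQ mP nQ fPQ.
have [S SE] := tens_swap A B; have [S' S'E] := tens_swap B A.
have [||lam [F [FE lamP FC Faway]]] :=
    @cauchy_contraction k B A n m (fun l => S (f l)) N0 Q P _ sQ sP nQ mP.
- move=> N; have [L LP] := fC N; exists L => i j Li Lj.
  by rewrite -raddfB; apply: tens_swap_nbhs => //; exact: LP.
- move=> L; have [l Ll nf] := fPQ L; exists l => // H; apply: nf.
  by rewrite -(tens_swapK (f l) SE S'E); exact: tens_swap_nbhs.
exists lam, (F \o S : {additive _ -> _}); split=> // a b.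
by rewrite /= SE FE.
Qed.

(** * Leading forms *)

Section Multiples.
Variables (R : comPzRingType) (K : fieldType) (pt : {rmorphism R -> K}).
Implicit Types (X : set K) (a b : R).

(** For [X = stabilizer M], these are the elements of value at least that of [a]; for [X = M] and
    [pt a != 0], those of larger value. The value group itself is never formed. *)
Definition multiples X a : set R := [set y | exists2 t, X t & pt y = pt a * t].

Lemma multiples_trans X X' X'' a b y :
  (forall s t, X s -> X' t -> X'' (s * t)) ->
  multiples X a b -> multiples X' b y -> multiples X'' a y.
Proof.
move=> H [s Xs E] [t Xt E']; exists (s * t); first exact: H.
by rewrite E' E mulrA.
Qed.

Lemma multiplesM X X' X'' a a' y y' :
  (forall s t, X s -> X' t -> X'' (s * t)) ->
  multiples X a y -> multiples X' a' y' -> multiples X'' (a * a') (y * y').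
Proof.
move=> H [s Xs E] [t Xt E']; exists (s * t); first exact: H.
by rewrite !rmorphM E E'; ring.
Qed.

Variables (S0 M : set K).
Hypothesis placeM : place S0 M.
Let sM : subplace S0 M := placeM.1.
Local Notation V := (stabilizer M).

Lemma multiples_refl a : multiples V a a.
Proof. by exists 1; [exact: stabilizer1|rewrite mulr1]. Qed.

Lemma multiples_sub a : multiples M a `<=` multiples V a.
Proof. by move=> y [t Mt E]; exists t => //;
  exact: (place_sub_stabilizer placeM). Qed.

Lemma multiples_total a b : multiples V a b \/ multiples V b a.
Proof.
have M0 : V 0 by move=> y _; rewrite mul0r; exact: (subplace0 sM).
have [a0|a0] := eqVneq (pt a) 0.
  by right; exists 0; rewrite ?mulr0.
have [b0|b0] := eqVneq (pt b) 0; first by left; exists 0; rewrite ?mulr0.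
have [Vba|] := pselect (V (pt b / pt a)).
  by left; exists (pt b / pt a); rewrite // mulrC divfK.
move=> /(stabilizer_total placeM b0 a0) Mab.
by right; exists (pt a / pt b);
  [exact: (place_sub_stabilizer placeM)|rewrite mulrC divfK].
Qed.

Lemma multiples_strict a b : pt b != 0 -> ~ multiples V a b -> multiples M b a.
Proof.
move=> b0 nab.
have [a0|a0] := eqVneq (pt a) 0; first by exists 0; rewrite ?mulr0//;
  exact: (subplace0 sM).
have [Vba|] := pselect (V (pt b / pt a)).
  by case: nab; exists (pt b / pt a); rewrite // mulrC divfK.
move=> /(stabilizer_total placeM b0 a0) Mab.
by exists (pt a / pt b); rewrite // mulrC divfK.
Qed.

Lemma multiples_irrefl a : pt a != 0 -> ~ multiples M a a.
Proof.
move=> a0 [t Mt E]; apply: (subplace1 sM); suff -> : 1 = t by [].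
by apply: (mulfI a0); rewrite mulr1.
Qed.

Lemma multiples_closed X a : X 0 -> (forall x y, X x -> X y -> X (x + y)) ->
  (forall x, X x -> X (- x)) ->
  [/\ multiples X a 0,
   forall x y, multiples X a x -> multiples X a y -> multiples X a (x + y) &
   forall x, multiples X a x -> multiples X a (- x)].
Proof.
move=> X0 XD XN; split.
- by exists 0; rewrite // rmorph0 mulr0.
- move=> x y [s Xs E] [t Xt E']; exists (s + t); first exact: XD.
  by rewrite rmorphD E E' mulrDr.
- by move=> x [s Xs E]; exists (- s); [exact: XN|rewrite rmorphN E mulrN].
Qed.

Lemma multiples_ideal a : (forall b, V (pt b)) -> is_ideal (multiples M a).
Proof.
move=> VR; have [H0 HD _] :=
  multiples_closed a (subplace0 sM) (subplaceD sM) (subplaceN sM).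
split=> // b x [t Mt E]; exists (pt b * t); first exact: VR.
by rewrite rmorphM E mulrCA.
Qed.

Lemma multiples_stab_ideal a : (forall b, V (pt b)) -> is_ideal (multiples V a).
Proof.
move=> VR.
have V0 : V 0 by move=> y _; rewrite mul0r; exact: (subplace0 sM).
have [H0 HD _] := multiples_closed a V0 (stabilizerD placeM) (stabilizerN placeM).
split=> // b x [t Mt E]; exists (pt b * t); last by rewrite rmorphM E mulrCA.
exact: (stabilizerM (VR b) Mt).
Qed.

End Multiples.

Section MultiplesAlg.
Variables (k : fieldType) (A : comAlgType k) (K : fieldType) (pt :
  {rmorphism A -> K}).
Variables (S0 M : set K).
Hypothesis placeM : place S0 M.
Hypothesis Vk : forall c : k, stabilizer M (pt c%:A).
Let sM : subplace S0 M := placeM.1.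

Lemma pt_scale c a : pt (c *: a) = pt c%:A * pt a.
Proof. by rewrite -rmorphM mulr_algl. Qed.

Lemma multiples_subspace a : subspace (multiples pt M a).
Proof.
have [H0 HD _] := multiples_closed pt a (subplace0 sM) (subplaceD sM)
  (subplaceN sM).
split=> // c x [t Mt E]; exists (pt c%:A * t); first exact: Vk.
by rewrite pt_scale E mulrCA.
Qed.

Lemma multiples_stab_subspace a : subspace (multiples pt (stabilizer M) a).
Proof.
have V0 : stabilizer M 0 by move=> y _; rewrite mul0r; exact: (subplace0 sM).
have [H0 HD _] := multiples_closed pt a V0 (stabilizerD placeM) (stabilizerN
  placeM).
split=> // c x [t Mt E]; exists (pt c%:A * t); last by rewrite pt_scale E mulrCA.
exact: (stabilizerM (Vk c) Mt).
Qed.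

End MultiplesAlg.

(** * Leading tensors of finite sums *)

Section LeadingTerm.
Variables (k : fieldType) (A B : comAlgType k) (K : fieldType).
Variables (pt : {rmorphism A -> K}) (S0 M : set K) (G G' : set B).
Hypothesis placeM : place S0 M.
Hypothesis Vk : forall c : k, stabilizer M (pt c%:A).
Hypothesis Vres : forall x, stabilizer M x -> exists c : k, M (x - pt c%:A).
Hypotheses (sG : subspace G) (sG' : subspace G').
Let sM : subplace S0 M := placeM.1.
Local Notation Pp := (multiples pt M).

Lemma exists_dominant (s : seq (A * B)) : s != [::] ->
  exists2 p, p \in s & forall p', p' \in s ->
    multiples pt (stabilizer M) p.1 p'.1.
Proof.
elim: s => // p [|q s] IH _.
  exists p; rewrite ?mem_head// => p'; rewrite inE => /eqP->.
  exact: multiples_refl.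
have [//|r rs rdom] := IH; have trans := multiples_trans (@stabilizerM _ M).
have [pr|rp] := multiples_total pt placeM p.1 r.1.
  exists p; first exact: mem_head.
  move=> p'; rewrite inE => /predU1P[->|/rdom rp']; first exact: multiples_refl.
  exact: trans pr rp'.
exists r; first by rewrite inE rs orbT.
by move=> p'; rewrite inE => /predU1P[->|/rdom].
Qed.

(** Let [a0] have least value. As the residue field is [k], every left factor is [c *: a0] plus
    something of larger value; moving [c] across the tensor sign collects one tensor [a0 (x) b0]. If
    [b0] is in [G'], the leading terms have cancelled and a list with one term fewer remains. *)
Lemma leading_term (s : seq (A * B)) : (forall p, p \in s -> G p.2) ->
  tens_span (fun a b => G' b \/ pt a = 0) (tens_sum s) \/
  exists a0 b0, [/\ pt a0 != 0, G b0, ~ G' b0 &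
    tens_span (fun a b => (Pp a0 a /\ G b) \/ G' b) (tens_sum s - tens a0 b0)].
Proof.
have [n] := ubnP (size s); elim: n s => // n IH s sn sGs.
have [s0|s0] := eqVneq s [::].
  by left; rewrite s0 /tens_sum big_nil; exact: tens_span0.
have [[a0 b] ps dom] := exists_dominant s0.
have [a00|a00] := eqVneq (pt a0) 0.
  left; exists s => // p /dom[t _ E]; right.
  by rewrite E a00 mul0r.
have sperm := perm_to_rem ps; pose r := rem (a0, b) s.
have sE : tens_sum s = tens a0 b + tens_sum r.
  by rewrite /tens_sum (perm_big _ sperm) big_cons.
have rs p : p \in r -> p \in s by move=> pr; rewrite (perm_mem sperm) inE pr orbT.
have H (a : A) : exists c : k, multiples pt (stabilizer M) a0 a ->
  Pp a0 (a - c *: a0).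
  have [[t Vt E]|na] := pselect (multiples pt (stabilizer M) a0 a);
    last by exists 0.
  have [c Mc] := Vres Vt; exists c => _; exists (t - pt c%:A) => //.
  by rewrite rmorphB pt_scale E; ring.
have {H}[c cP] := choice H.
pose r' := [seq (p.1 - c p.1 *: a0, p.2) | p <- r].
pose b0 := b + \sum_(p <- r) c p.1 *: p.2.
have sE' : tens_sum s = tens_sum r' + tens a0 b0.
  rewrite sE /b0 tensDr tens_sumr [RHS]addrCA; congr (_ + _).
  rewrite /tens_sum big_map -big_split; apply: eq_bigr => p _ /=.
  by rewrite tensDl -scaleNr tensZ scaleNr -addrA -tensDr addNr tens0r addr0.
have [G0 GD GZ] := sG.
have Gb0 : G b0.
  apply: (GD); first exact: (sGs (a0, b)).
  rewrite big_seq; apply: big_ind => [||p pr]; [exact: G0|exact: GD|].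
  by apply: GZ; apply: sGs; exact: rs.
have Pr' p : p \in r' -> Pp a0 p.1 /\ G p.2.
  move=> /mapP[q qr ->] /=; split; last by apply: sGs; exact: rs.
  by apply: cP; exact: dom (rs _ qr).
have [G'b0|nG'b0] := pselect (G' b0); last first.
  right; exists a0, b0; split=> //; rewrite sE' addrK.
  by exists r' => // p /Pr'; left.
have r'n : (size r' < n)%N.
  have := perm_size sperm; rewrite size_map /= -/r => szs.
  by move: sn; rewrite szs.
have [|X|[a1 [b1 [a10 Gb1 nG'b1 X]]]] := IH r' r'n.
- by move=> p /Pr'[].
- by left; rewrite sE'; apply: tens_spanD => //; apply: tens_span_gen; left.
- right; exists a1, b1; split=> //; rewrite sE' addrAC; apply: tens_spanD => //.
  by apply: tens_span_gen; right.
Qed.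

End LeadingTerm.

Lemma tens_nbhs_split (k : fieldType) (A B : comAlgType k) (P : set A) (Q :
  set B) x :
  tens_nbhs P Q x -> exists2 s : seq (A * B), (forall p, p \in s -> Q p.2) &
    tens_span (fun a _ => P a) (x - tens_sum s).
Proof.
move: x; apply: tens_span_ind => [|x y [s sQ Hs] [t tQ Ht]|a b [Pa|Qb]].
- by exists [::]; rewrite // /tens_sum big_nil subrr; exact: tens_span0.
- exists (s ++ t); first by move=> p; rewrite mem_cat => /orP[/sQ|/tQ].
  rewrite /tens_sum big_cat /= opprD addrACA; exact: tens_spanD.
- exists [::] => //; rewrite /tens_sum big_nil subr0; exact: tens_span_gen.
- exists [:: (a, b)]; first by move=> p; rewrite inE => /eqP->.
  by rewrite /tens_sum big_seq1 subrr; exact: tens_span0.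
Qed.

(** * Leading forms of Cauchy sequences and of their products *)

Section LeadingForm.
Variables (k : fieldType) (A B : comAlgType k) (m : set A) (n : set B).
Hypotheses (mI : is_ideal m) (nI : is_ideal n) (noethB : noetherian B).
Variables (K : fieldType) (phi : {rmorphism completion m -> K}) (S0 M : set K).
Hypotheses (placeM : place S0 M) (tameM : tame_place phi M).
Hypothesis Vk : forall c : k, stabilizer M (base_restr phi c%:A).
Hypothesis Vres : forall x, stabilizer M x -> exists c : k,
  M (x - base_restr phi c%:A).
Variables (L : fieldType) (psi : {rmorphism completion n -> L}) (S1 N : set L).
Hypotheses (placeN : place S1 N) (tameN : tame_place psi N).
Hypothesis WB : forall b : B, stabilizer N (base_restr psi b).
Local Notation pA := (base_restr phi).
Local Notation pB := (base_restr psi).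
Local Notation V := (stabilizer M).
Local Notation W := (stabilizer N).
Local Notation Pp := (multiples pA M).
Local Notation G := (multiples pB W).
Local Notation Gp := (multiples pB N).
Implicit Types (f g : nat -> tensor A B).

Let GI b : is_ideal (G b) := multiples_stab_ideal placeN b WB.
Let GpI b : is_ideal (Gp b) := multiples_ideal placeN b WB.
Let kerA i := kernel_nbhs_ideal phi i.

Lemma kernel_nbhs_multiples b : pB b != 0 ->
  exists i, kernel_nbhs psi i `<=` Gp b.
Proof.
move=> b0; have [i iP] := tameN.2 _ b0; exists i => y [z /iP[t Nt E] Ey].
by exists t => //; exact: etrans Ey E.
Qed.

(* The least value on the coefficients of [f] is attained because it corresponds
   to a maximal element of a family of ideals of [B]. *)
Lemma exists_least_value f i (lam : A -> k) (F : {additive tensor A B -> B}) :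
  tens_cauchy m n f ->
  (forall a b, F (tens a b) = lam a *: b) ->
  (forall a, kernel_nbhs phi i a -> lam a = 0) ->
  adic_cauchy n (fun l => F (f l)) ->
  psi (compl_class n (fun l => F (f l))) != 0 ->
  exists b, [/\ pB b != 0,
    exists j, forall l0, exists2 l, (l0 <= l)%N &
      ~ tens_nbhs (kernel_nbhs phi j) (Gp b) (f l) &
    forall j, exists l0, forall l, (l0 <= l)%N ->
      tens_nbhs (kernel_nbhs phi j) (G b) (f l)].
Proof.
move=> fC FE lam0 FC F0.
have sker j : subspace (kernel_nbhs phi j) := ideal_subspace (kerA j).
have contrF (lam' : A -> k) (F' : {additive tensor A B -> B}) P Q x :
    (forall a b, F' (tens a b) = lam' a *: b) -> is_ideal Q ->
    (forall a, P a -> lam' a = 0) -> tens_nbhs P Q x -> Q (F' x).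
  move=> F'E QI P0; have [Q0 QD QZ] := ideal_subspace QI.
  move: x; apply: tens_span_ind => [|x y Hx Hy|a b H].
  - by rewrite raddf0.
  - by rewrite raddfD; exact: QD.
  - by rewrite F'E; case: H => [/P0->|]; [rewrite scale0r|exact: QZ].
(* [Y b]: modulo an open ideal of [A], [f] keeps having coefficients of value at most that of [b].
   Since [G b] grows as the value of [b] drops, a maximal [G b] gives the least value. *)
pose Y b := pB b != 0 /\ exists j, forall l0, exists2 l, (l0 <= l)%N &
  ~ tens_nbhs (kernel_nbhs phi j) (Gp b) (f l).
have YP (lam' : A -> k) (F' : {additive tensor A B -> B}) j b d l0 :
    (forall a b, F' (tens a b) = lam' a *: b) ->
    (forall a, kernel_nbhs phi j a -> lam' a = 0) -> pB b != 0 ->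
    ideal_exp n d `<=` Gp b ->
    (forall l, (l0 <= l)%N -> ideal_exp n d (F' (f l) - b)) -> Y b.
  move=> F'E lam'0 b0 dG Fb; split=> //; exists j => l1.
  exists (maxn l0 l1); first exact: leq_maxr.
  move=> /(contrF _ _ _ _ _ F'E (GpI b) lam'0) H.
  apply: (multiples_irrefl placeN b0).
  rewrite -{2}(subKr (F' (f (maxn l0 l1))) b); apply: (is_idealB (GpI b)) => //.
  by apply: dG; apply: Fb; exact: leq_maxl.
have [b Yb] : exists b, Y b.
  have [l0 lP] := class_value placeN tameN FC F0.
  have [d dP] := tameN.2 _ F0.
  have [l1 l1P] := FC d.
  pose l := maxn l0 l1; have [t Nt Et] := lP l (leq_maxl _ _).
  have u1 : 1 + t != 0.
    apply/eqP => /eqP; rewrite addr_eq0 => /eqP E; apply: (subplace1 placeN.1).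
    by rewrite E; exact: (subplaceN placeN.1).
  have u1V : W (1 + t)^-1.
    rewrite -[t]opprK; apply: (stabilizerV1sub placeN).
    exact: (subplaceN placeN.1).
  exists (F (f l)); apply: (YP lam F i _ d l1) => //.
  - by rewrite Et mulf_neq0.
  - move=> y ny; have [t' Nt' E'] := dP _ (closed_pow_cst ny).
    exists ((1 + t)^-1 * t'); first exact: u1V.
    by rewrite /= Et mulrA mulfK.
  - by move=> l' Ll'; apply: l1P => //; exact: leq_maxr.
have [||_ [b1 Yb1 <-] bmax] :=
    @noetherian_max _ noethB [set G b | b in [set b | Y b]] (G b).
- by exists b.
- by move=> _ [b' _ <-]; exact: GI.
have [b10 b1away] := Yb1.
exists b1; split=> // j; apply: contrapT => nj.
have [d0 d0P] := kernel_nbhs_multiples b10.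
have nd0 : ideal_exp n d0 `<=` G b1.
  by move=> y /(ideal_exp_kernel_nbhs psi)/d0P; exact: (multiples_sub placeN).
pose d := maxn d0 j.
(* If [f] left [G b1] infinitely often, a contraction would produce [b2] of smaller value, still in
   [Y], against maximality. *)
have [||||l0|lam' [F' [F'E lam'0 F'C [l0 F'away]]]] :=
    @cauchy_contraction_left k A B m n f d (kernel_nbhs phi j) (G b1) fC.
- exact: sker.
- exact/ideal_subspace/GI.
- move=> y /(ideal_exp_kernel_nbhs phi); apply: kernel_nbhs_sub; exact: leq_maxr.
- by move=> y H; apply/nd0/(ideal_exp_sub _ H); exact: leq_maxl.
- apply: contrapT => H; apply: nj; exists l0 => l Ll; apply: contrapT => nf.
  by apply: H; exists l.
have [l1 l1P] := F'C d0.
pose l := maxn l0 l1; pose b2 := F' (f l).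
have nGb2 : ~ G b1 b2 by apply: F'away; exact: leq_maxl.
have b20 : pB b2 != 0.
  apply/eqP => b20; apply: nGb2; exists 0; rewrite ?b20 ?mulr0// => y _.
  by rewrite mul0r; exact: (subplace0 placeN.1).
have b12 : Gp b2 b1 := multiples_strict placeN b20 nGb2.
have GpG : G b1 `<=` Gp b2.
  move=> y; apply: multiples_trans b12 => s t Ns Wt; rewrite mulrC; exact: Wt.
apply: nGb2; apply: (bmax (G b2)).
- exists b2 => //; apply: (YP lam' F' j _ d0 l1) => //.
    by move=> y /nd0/GpG.
  by move=> l' Ll'; apply: l1P => //; exact: leq_maxr.
- by move=> y /GpG; exact: (multiples_sub placeN).
- exact: multiples_refl.
Qed.

(** The errors allowed beside [a0 (x) b0]: same or larger [w] with larger [v]; larger [w], whatever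
    the value of [a]; or [a] in an ideal too small to matter. *)
Definition small_terms a0 b0 i (a : A) (b : B) :=
  [\/ Pp a0 a /\ G b0 b, Gp b0 b | kernel_nbhs phi i a].

(** The leading tensor varies with [l] and the accuracy [i], but [x] and [y], whose values bound
    those of [a0] and [b0] from above, do not. A product can thus fix its accuracy before the
    index. *)
Definition has_leading_form f := exists x y, [/\ phi x != 0, psi y != 0 &
  forall i, (forall z, kernel_nbhs phi i z -> exists2 t,
    M t & pA z = phi x * t) ->
  exists l0, forall l, (l0 <= l)%N -> exists a0 b0,
    [/\ exists2 v, V v & phi x = pA a0 * v, exists2 w, W w & psi y = pB b0 * w &
        tens_span (small_terms a0 b0 i) (f l - tens a0 b0)]].

Lemma exists_leading_form f i (lam : A -> k) (F : {additive tensor A B -> B}) :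
  tens_cauchy m n f ->
  (forall a b, F (tens a b) = lam a *: b) ->
  (forall a, kernel_nbhs phi i a -> lam a = 0) ->
  adic_cauchy n (fun l => F (f l)) ->
  psi (compl_class n (fun l => F (f l))) != 0 ->
  has_leading_form f.
Proof.
move=> fC FE lam0 FC F0.
have [b1 [b10 [j jaway] near]] := exists_least_value fC FE lam0 FC F0.
have [d0 d0P] := kernel_nbhs_multiples b10.
(* Killing [Gp b1], the functional contraction [E] sees only the coefficients of least value [w].
   Its nonzero limit [alpha] will bound [v] on the leading tensor. *)
have [|||||mu [E [EE mu0 EC Eaway]]] :=
    @cauchy_contraction k A B m n f (maxn d0 j) (kernel_nbhs phi j) (Gp b1) fC.
- exact/ideal_subspace/kerA.
- exact/ideal_subspace/GpI.
- move=> y /(ideal_exp_kernel_nbhs phi); apply: kernel_nbhs_sub; exact: leq_maxr.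
- move=> y /(ideal_exp_kernel_nbhs psi) H; apply: d0P; apply: kernel_nbhs_sub H.
  exact: leq_maxl.
- exact: jaway.
pose alpha := phi (compl_class m (fun l => E (f l))).
have alpha0 : alpha != 0.
  apply: (@class_neq0 _ _ _ phi _ j EC) => l; have [l1 H] := Eaway.
  by exists (maxn l l1); [exact: leq_maxl|apply: H; exact: leq_maxr].
exists (compl_class m (fun l => E (f l))), (compl_cst n b1); split=> // d dP.
have [l0 l0P] := class_value placeM tameM EC alpha0; have [l1 l1P] := near d.
exists (maxn l0 l1) => l; rewrite geq_max => /andP[Ll0 Ll1].
have [s sG us] := tens_nbhs_split (l1P _ Ll1).
have [t Mt Et] := l0P _ Ll0.
have [t' Mt' Et'] : exists2 t', M t' & pA (E (f l - tens_sum s)) = alpha * t'.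
  apply: dP; apply: (contract_nbhs EE _ mu0); first exact/ideal_subspace/kerA.
  by apply: tens_span_mono us => a b; left.
pose w := t' - t; have Mw : M w.
  by apply: (subplaceD placeM.1) => //; exact: (subplaceN placeM.1).
have w1 : 1 - w != 0.
  by apply/eqP => /subr0_eq H; apply: (subplace1 placeM.1); rewrite H.
have EsE : pA (E (tens_sum s)) = alpha * (1 - w).
  have -> : tens_sum s = f l - (f l - tens_sum s) by rewrite subKr.
  by rewrite raddfB rmorphB /= Et Et'; rewrite /w; ring.
have sGb1 : subspace (G b1) := ideal_subspace (GI b1).
have sGpb1 : subspace (Gp b1) := ideal_subspace (GpI b1).
(* Total cancellation at the least value would make the contraction vanish, but it equals
   [alpha * (1 - w)]. *)
have [X|[a0 [b0 [a00 Gb0 nGpb0 X]]]] :=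
    leading_term (Gp b1) placeM Vres sGb1 sG.
  have : pA (E (tens_sum s)) = 0.
    move: X; apply: (@tens_span_ind _ _ _ _ [set x | pA (E x) = 0]).
    - by rewrite /= raddf0 rmorph0.
    - by move=> x y /= Hx Hy; rewrite raddfD rmorphD /= Hx Hy addr0.
    - move=> a b H; rewrite /= EE pt_scale.
      by case: H => [/mu0->|->]; rewrite ?scale0r ?rmorph0 ?mul0r ?mulr0.
  by rewrite EsE => /eqP; rewrite mulf_eq0 (negbTE alpha0) (negbTE w1).
have [w' Ww' b0E] := Gb0.
have nNw' : ~ N w' by move=> Nw'; apply: nGpb0; exists w'.
have w'0 : w' != 0.
  by apply/eqP => w'0; apply: nNw'; rewrite w'0; exact: (subplace0 placeN.1).
have Ww'V : W w'^-1 := stabilizer_unit placeN Ww' nNw'.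
have b1E : G b0 b1 by exists w'^-1; rewrite // b0E mulfK.
exists a0, b0; split.
(* Every term either has its left factor in [V a0] or is lost in the contraction, so the value of
   [alpha] is at least that of [a0]. *)
- have [v Vv Ev] : multiples pA V a0 (E (tens_sum s)).
    have sVa0 := multiples_stab_subspace placeM Vk a0; have [Q0 QD QZ] := sVa0.
    rewrite -(subrK (tens a0 b0) (tens_sum s)) raddfD; apply: QD; last first.
      by rewrite EE; apply: QZ; exact: multiples_refl.
    apply: (contract_nbhs EE sVa0 mu0).
    apply: tens_span_mono X => a b [[Pa _]|]; [left|by right].
    exact: (multiples_sub placeM).
  exists (v * (1 - w)^-1).
    exact: (stabilizerM Vv (stabilizerV1sub placeM Mw)).
  by rewrite mulrA -Ev /= EsE mulfK.
- by exists w'^-1; rewrite // b0E mulfK.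
- rewrite (_ : _ - _ = (f l - tens_sum s) + (tens_sum s - tens a0 b0));
  last first.
    by rewrite subrKA.
  apply: tens_spanD.
    by apply: tens_span_mono us => a b Ha; apply: Or33.
  apply: tens_span_mono X => a b [[Pa Gb]|Gpb].
    by apply: Or31; split=> //;
      exact: (multiples_trans (@stabilizerM _ N) b1E Gb).
  by apply: Or32; apply: multiples_trans b1E Gpb => x y Wx Ny; exact: Wx.
Qed.

(** Multiplying two errors, or an error and a leading tensor, increases [w], or [v] at no loss of
    [w], except for factors in [kernel_nbhs]. These are safe because that ideal absorbs any
    multiplier from [A], even one of negative value. *)
Lemma leading_form_mul f g : has_leading_form f -> has_leading_form g ->
  ~ forall i, exists l0, forall l, (l0 <= l)%N -> adic_nbhs m n i (f l * g l).
Proof.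
move=> [x [y [x0 y0 fP]]] [x' [y' [x'0 y'0 gP]]] fg0.
have [i0 i0P] := tameM.2 _ x0; have [i1 i1P] := tameM.2 _ x'0.
have [i2 i2P] : exists i, forall z, closed_pow i z ->
    exists2 t, M t & phi z = phi (x * x') * t.
  by apply: tameM.2; rewrite rmorphM mulf_neq0.
have [j jP] : exists j, forall z, closed_pow j z ->
    exists2 t, N t & psi z = psi (y * y') * t.
  by apply: tameN.2; rewrite rmorphM mulf_neq0.
(* [i0] and [i1] give access to the two leading forms; [i2] lifts the ideal above the value of
   [x * x'], hence into [P] whichever [a0] and [a1] occur later. *)
pose i := maxn i0 (maxn i1 i2).
have kerP z : kernel_nbhs phi i z ->
    exists2 t, M t & pA z = phi (x * x') * t.
  move=> [u cu ->]; apply/i2P/(closed_pow_sub _ cu).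
  by rewrite !leq_max leqnn !orbT.
have [z|lf lfP] := fP i.
  move=> [u cu ->]; apply/i0P/(closed_pow_sub _ cu).
  by rewrite leq_max leqnn.
have [z|lg lgP] := gP i.
  move=> [u cu ->]; apply/i1P/(closed_pow_sub _ cu).
  by rewrite !leq_max leqnn !orbT.
have [lfg lfgP] := fg0 (maxn i j).
pose l := maxn lf (maxn lg lfg).
have [a0 [b0 [[v Vv xE] [w Ww yE] fl]]] := lfP l (leq_maxl _ _).
have [|a1 [b1 [[v' Vv' xE'] [w' Ww' yE'] gl]]] := lgP l.
  by rewrite !leq_max leqnn !orbT.
have {lfgP}fgl : adic_nbhs m n (maxn i j) (f l * g l).
  by apply: lfgP; rewrite !leq_max leqnn !orbT.
have a00 : pA a0 != 0 by apply: contraNneq x0; rewrite xE => ->; rewrite mul0r.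
have a10 : pA a1 != 0 by apply: contraNneq x'0; rewrite xE' => ->; rewrite mul0r.
have b00 : pB b0 != 0 by apply: contraNneq y0; rewrite yE => ->; rewrite mul0r.
have b10 : pB b1 != 0 by apply: contraNneq y'0; rewrite yE' => ->; rewrite mul0r.
pose P := Pp (a0 * a1); pose Q := Gp (b0 * b1).
have sP : subspace P := multiples_subspace placeM Vk (a0 * a1).
have QI : is_ideal Q := GpI (b0 * b1); have sQ := ideal_subspace QI.
have kerPP z : kernel_nbhs phi i z -> P z.
  move=> /kerP[t Mt E]; exists (v * (v' * t)); first exact/Vv/Vv'.
  by rewrite [LHS]E !rmorphM xE xE' /=; ring.
have kerQ z : kernel_nbhs psi j z -> Q z.
  move=> [u /jP[t Nt E] Eu]; exists (w * (w' * t)); first exact/Ww/Ww'.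
  by rewrite [LHS]Eu E !rmorphM yE yE' /=; ring.
have MV s t : M s -> V t -> M (s * t) by move=> Ms Vt; rewrite mulrC; exact: Vt.
have VM s t : V s -> M t -> M (s * t) by exact.
have NW s t : N s -> W t -> N (s * t) by move=> Ns Wt; rewrite mulrC; exact: Wt.
have WN s t : W s -> N t -> N (s * t) by exact.
have kerMl a a' : kernel_nbhs phi i a -> P (a * a').
  by move=> ka; apply: kerPP; exact: (ideal_mulr _ (kerA i)).
have kerMr a a' : kernel_nbhs phi i a' -> P (a * a').
  by move=> ka; apply: kerPP; exact: (ideal_mull _ (kerA i)).
(* Terms of [g] with its leading tensor included, hence [V] in place of [M]. *)
pose Z a b := [\/ multiples pA V a1 a /\ G b1 b, Gp b1 b | kernel_nbhs phi i a].
have Zg : tens_span Z (g l).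
  rewrite -(subrK (tens a1 b1) (g l)); apply: tens_spanD.
    apply: tens_span_mono gl => a b [[Pa Gb]|Gpb|ka]; [|exact: Or32|exact: Or33].
    by apply: Or31; split=> //; exact: (multiples_sub placeM).
  by apply: tens_span_gen; apply: Or31; split; exact: multiples_refl.
have diff : tens_nbhs P Q (f l * g l - tens (a0 * a1) (b0 * b1)).
  rewrite (_ : _ - _ = (f l - tens a0 b0) * g l + tens a0 b0 * (g l - tens a1
    b1)).
    apply: tens_spanD.
      apply: tens_spanM fl Zg => a b a' b' [[Pa Gb]|Gpb|ka] [[Va' Gb']|Gpb'|ka'];
        try (by left; apply: kerMl); try (by left; apply: kerMr).
      - by left; exact: multiplesM MV Pa Va'.
      - by right; exact: multiplesM WN Gb Gpb'.
      - by right; exact: multiplesM NW Gpb Gb'.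
      - by right; exact: multiplesM WN (multiples_sub placeN Gpb) Gpb'.
    have t0 : tens_span (fun a b => a = a0 /\ b = b0) (tens a0 b0).
      exact: tens_span_gen.
    apply: tens_spanM t0 gl => a b a' b' [-> ->] [[Pa' Gb']|Gpb'|ka'].
    - by left; exact: multiplesM VM (multiples_refl pA M a0) Pa'.
    - by right; exact: multiplesM WN (multiples_refl pB N b0) Gpb'.
    - by left; exact: kerMr.
  by rewrite tensM mulrBl mulrBr addrA subrK.
have near : tens_nbhs P Q (f l * g l).
  apply: tens_nbhs_mono fgl => z H; [apply: kerPP|apply: kerQ].
    by apply: ideal_exp_kernel_nbhs; apply: ideal_exp_sub H; exact: leq_maxl.
  by apply: ideal_exp_kernel_nbhs; apply: ideal_exp_sub H; exact: leq_maxr.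
have nQ : ~ Q (b0 * b1).
  by apply: (multiples_irrefl placeN); rewrite rmorphM mulf_neq0.
(* The product is itself negligible, so [a0 * a1 (x) b0 * b1] lies in [P (x) B + A (x) Q];
   contracting with [mu] would place [a0 * a1] in [P]. *)
have [mu [mul muQ mu1]] := exists_functional sQ nQ.
have [F FE] := contract_right A mul.
have : P (F (tens (a0 * a1) (b0 * b1))).
  apply: (contract_nbhs FE sP muQ).
  rewrite -(subKr (f l * g l) (tens (a0 * a1) (b0 * b1))).
  exact: tens_nbhsB.
rewrite FE mu1 scale1r; apply: (multiples_irrefl placeM).
by rewrite rmorphM mulf_neq0.
Qed.

End LeadingForm.

(** * Completed tensor products *)

(** The ideal generated by [i I] needs only finitely many generators [i t] with [t] in [I]. Applying
    [F], which is linear along [i], shows that these [t] generate [I]. *)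
Lemma noetherian_retract (R S : comPzRingType) (i : S -> R)
    (F : {additive R -> S}) :
  (forall x r, F (i x * r) = x * F r) -> (forall x, F (i x) = x) ->
  noetherian R -> noetherian S.
Proof.
move=> FM Fi noethR I II.
pose span (T : seq S) := ideal_gen [set` map i T].
have spanI T : is_ideal (span T) := ideal_gen_ideal _.
have span_mono T T' : {subset T <= T'} -> span T `<=` span T'.
  move=> TT'; apply: ideal_gen_min => // _ /mapP[t /TT' tT' ->].
  by apply: sub_ideal_gen; exact: map_f.
have fin r : ideal_gen [set i x | x in I] r ->
    exists2 T, {in T, forall t, I t} & span T r.
  apply: (@ideal_gen_min _ _ [set r | exists2 T, {in T, forall t,
    I t} & span T r]).
    split.
    - by exists [::] => //; exact: (ideal0 (spanI _)).
    - move=> x y [T TI Tx] [T' T'I T'y]; exists (T ++ T').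
        by move=> t; rewrite mem_cat => /orP[/TI|/T'I].
      apply: (idealD (spanI _)).
        by apply: span_mono Tx => t tT; rewrite mem_cat tT.
      by apply: span_mono T'y => t tT; rewrite mem_cat tT orbT.
    - by move=> a x [T TI Tx]; exists T => //; exact: (ideal_mull _ (spanI _)).
  move=> _ [x Ix <-]; exists [:: x]; first by move=> t; rewrite inE => /eqP->.
  by apply: sub_ideal_gen; rewrite /= mem_head.
have [s Es] := noethR _ (ideal_gen_ideal [set i x | x in I]).
have [T TI sT] : exists2 T, {in T, forall t, I t} & [set` s] `<=` span T.
  have : [set` s] `<=` ideal_gen [set i x | x in I].
    by rewrite Es; exact: sub_ideal_gen.
  elim: s {Es} => [|r s IH] sI; first by exists [::].
  have [|T TI sT] := IH; first by move=> x xs; apply: sI; rewrite /= inE xs orbT.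
  have [|T' T'I T'r] := fin r; first by apply: sI; rewrite /= mem_head.
  exists (T ++ T'); first by move=> t; rewrite mem_cat => /orP[/TI|/T'I].
  move=> x; rewrite /= inE => /predU1P[->|xs].
    by apply: span_mono T'r => t tT; rewrite mem_cat tT orbT.
  by apply: span_mono (sT _ xs) => t tT; rewrite mem_cat tT.
exists T; have TgI := ideal_gen_ideal [set` T].
apply/seteqP; split; last by apply: ideal_gen_min => // t; exact: TI.
move=> x Ix; rewrite -(Fi x) -[i x]mul1r.
suff H : span T `<=` [set r | forall r', ideal_gen [set` T] (F (r' * r))].
  apply: H; have : ideal_gen [set i x | x in I] (i x).
    by apply: sub_ideal_gen; exists x.
  by rewrite Es; apply: ideal_gen_min => //; exact: sT.
apply: ideal_gen_min.
  split=> [r'|r r' Hr Hr' r''|a r Hr r'] /=.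
  - by rewrite mulr0 raddf0; exact: (ideal0 TgI).
  - by rewrite mulrDr raddfD; apply: (idealD TgI); [exact: Hr|exact: Hr'].
  - by rewrite mulrA; exact: Hr.
move=> _ /mapP[t tT ->] r' /=; rewrite mulrC FM.
by apply: (ideal_mulr _ TgI); apply: sub_ideal_gen.
Qed.

(** * Completion of a retraction *)

Section AdicRetract.
Variables (S R : comPzRingType) (m : set S) (I : set R).
Variables (i : {rmorphism S -> R}) (F : {additive R -> S}).
Hypothesis FM : forall x r, F (i x * r) = x * F r.
Hypothesis F1 : F 1 = 1.
Hypothesis im : forall N x, ideal_exp m N x -> ideal_exp I N (i x).
Hypothesis FI : forall N, exists N', forall r, ideal_exp I N' r ->
  ideal_exp m N (F r).

Lemma retractK x : F (i x) = x.
Proof. by rewrite -[i x]mulr1 FM F1 mulr1. Qed.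

Lemma retract_cauchy f : adic_cauchy I f -> adic_cauchy m (F \o f).
Proof.
move=> fC N; have [N' N'P] := FI N; have [L LP] := fC N'.
by exists L => l l' Ll Ll'; rewrite /= -raddfB; apply: N'P; exact: LP.
Qed.

Lemma retract_null f : adic_null I f -> adic_null m (F \o f).
Proof.
move=> f0 N; have [N' N'P] := FI N; have [L LP] := f0 N'.
by exists L => l Ll; apply: N'P; exact: LP.
Qed.

Lemma section_cauchy u : adic_cauchy m u -> adic_cauchy I (i \o u).
Proof.
move=> uC N; have [L LP] := uC N.
by exists L => l l' Ll Ll'; rewrite /= -rmorphB; apply: im; exact: LP.
Qed.

Lemma section_null u : adic_null m u -> adic_null I (i \o u).
Proof. by move=> u0 N; have [L LP] := u0 N; exists L => l Ll; apply: im;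
  exact: LP. Qed.

Lemma section_null_inv u : adic_null I (i \o u) -> adic_null m u.
Proof.
move=> /retract_null; rewrite (_ : F \o (i \o u) = u)//.
by apply/funext => l /=; rewrite retractK.
Qed.

Lemma completion_retract_domain :
  is_domain (completion I) -> is_domain (completion m).
Proof.
move=> [R1 Rdom]; split.
  apply: contraNneq R1 => E; apply/eqP.
  have cC := @adic_cauchy_cst R I 1.
  rewrite -(rmorph1 (@compl_cst R I)); apply/(compl_class0P cC).
  have cC' := @adic_cauchy_cst S m 1.
  have : adic_null m (fun=> 1).
    by apply/(compl_class0P cC'); rewrite -E -(rmorph1 (@compl_cst S m)).
  by move=> /section_null; rewrite (_ : i \o _ = fun=> 1)//;
    apply/funext => l /=; rewrite rmorph1.
move=> x y; have [u uC <-] := compl_class_surj x;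
  have [v vC <-] := compl_class_surj y.
rewrite -compl_classM// => /(compl_class0P (adic_cauchyM uC vC))/section_null uv0.
have iuC := section_cauchy uC; have ivC := section_cauchy vC.
have : compl_class I (i \o u) * compl_class I (i \o v) = 0.
  rewrite -compl_classM//; apply/(compl_class0P (adic_cauchyM iuC ivC)).
  move: uv0; rewrite (_ : i \o _ = fun l => (i \o u) l * (i \o v) l)//.
  by apply/funext => l /=; rewrite rmorphM.
move=> /Rdom/orP[/eqP/(compl_class0P iuC)|/eqP/(compl_class0P ivC)]
  /section_null_inv H.
  by apply/orP; left; apply/eqP/(compl_class0P uC).
by apply/orP; right; apply/eqP/(compl_class0P vC).
Qed.

Definition completion_retract (x : completion I) : completion m :=
  compl_class m (F \o compl_repr x).

Lemma completion_retractE f : adic_cauchy I f ->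
  completion_retract (compl_class I f) = compl_class m (F \o f).
Proof.
move=> fC; set r := compl_repr (compl_class I f).
have rC : adic_cauchy I r by exact: cauchyP.
apply/compl_class_eqP; [exact: retract_cauchy|exact: retract_cauchy|].
have : adic_null I (fun l => r l - f l).
  by apply/(compl_class_eqP rC fC); rewrite compl_classE compl_reprK.
move=> /retract_null; rewrite (_ : F \o _ = fun l => (F \o r) l - (F \o f) l)//.
by apply/funext => l /=; rewrite raddfB.
Qed.

Lemma completion_retract_zmod : zmod_morphism completion_retract.
Proof.
move=> x y; have [f fC <-] := compl_class_surj x;
  have [g gC <-] := compl_class_surj y.
have gC' := adic_cauchyN gC; have FgC := retract_cauchy gC.
rewrite -compl_classN// -compl_classD// !completion_retractE//;
  last exact: adic_cauchyD.
rewrite -compl_classN// -compl_classD;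
  [|exact: retract_cauchy|exact: adic_cauchyN].
by congr compl_class; apply/funext => l /=; rewrite raddfB.
Qed.

HB.instance Definition _ := GRing.isZmodMorphism.Build (completion I)
  (completion m)
  completion_retract completion_retract_zmod.

Lemma completion_retract_noetherian :
  noetherian (completion I) -> noetherian (completion m).
Proof.
pose sec (x : completion m) : completion I := compl_class I (i \o compl_repr x).
apply: (@noetherian_retract _ _ sec completion_retract) => [x r|x].
  have [f fC <-] := compl_class_surj r.
  have xC : adic_cauchy m (compl_repr x) := cauchyP _.
  have ixC := section_cauchy xC; have FfC := retract_cauchy fC.
  rewrite -compl_classM// /= !completion_retractE//; last exact: adic_cauchyM.
  rewrite -{2}[x](@compl_reprK _ m) -compl_classE -compl_classM//.
  by congr compl_class; apply/funext => l /=; rewrite FM.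
have xC : adic_cauchy m (compl_repr x) := cauchyP _.
rewrite /sec /= completion_retractE; last exact: section_cauchy.
rewrite -[RHS](@compl_reprK _ m) -compl_classE.
by congr compl_class; apply/funext => l /=; rewrite retractK.
Qed.

End AdicRetract.

(** * Retractions of the tensor product onto its factors *)

Section TensorFactors.
Variables (k : fieldType) (A B : comAlgType k) (m : set A) (n : set B).
Hypotheses (mI : is_ideal m) (nI : is_ideal n) (m1 : ~ m 1) (n1 : ~ n 1).

Definition tens_left (a : A) : tensor A B := tens a 1.
Definition tens_right (b : B) : tensor A B := tens 1 b.

Fact tens_left_zmod : zmod_morphism tens_left.
Proof. by move=> a a'; rewrite /tens_left tensDl tensNl. Qed.
Fact tens_left_monoid : monoid_morphism tens_left.
Proof. by split=> // a a'; rewrite /tens_left -tensM mulr1. Qed.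
HB.instance Definition _ := GRing.isZmodMorphism.Build A (tensor A B)
  tens_left tens_left_zmod.
HB.instance Definition _ := GRing.isMonoidMorphism.Build A (tensor A B)
  tens_left tens_left_monoid.

Fact tens_right_zmod : zmod_morphism tens_right.
Proof.
move=> b b'; rewrite /tens_right tensDr; congr (_ + _).
by apply: (addrI (tens 1 b')); rewrite -tensDr !subrr tens0r.
Qed.
Fact tens_right_monoid : monoid_morphism tens_right.
Proof. by split=> // b b'; rewrite /tens_right -tensM mulr1. Qed.
HB.instance Definition _ := GRing.isZmodMorphism.Build B (tensor A B)
  tens_right tens_right_zmod.
HB.instance Definition _ := GRing.isMonoidMorphism.Build B (tensor A B)
  tens_right tens_right_monoid.

(** The retraction contracts with a functional on [B] that kills [n], hence is continuous, and takes
    1 to 1. *)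
Lemma tens_left_retract : exists F : {additive tensor A B -> A},
  [/\ forall a x, F (tens_left a * x) = a * F x, F 1 = 1 &
      forall N, exists N', forall x, ideal_exp (tensor_ideal m n) N' x ->
        ideal_exp m N (F x)].
Proof.
have [f [fl fn f1]] := exists_functional (ideal_subspace nI) n1.
have [F FE] := contract_right A fl; exists F; split.
- move=> a x; have := tens_spanT x; move: x.
  apply: tens_span_ind => [|x y Hx Hy|a' b' _];
    first by rewrite mulr0 raddf0 mulr0.
    by rewrite mulrDr !raddfD Hx Hy mulrDr.
  by rewrite -tensM !FE mul1r scalerAr.
- by rewrite -tens1 FE f1 scale1r.
(* The successor keeps the exponent on the side of [B] positive even for [N = 0], since [f] vanishes
   on [n] only. *)
move=> N; exists (N.+1 + N.+1)%N => x /(exp_sub_adic_nbhs mI nI) H.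
apply: (contract_nbhs FE (ideal_subspace (ideal_exp_ideal m N)) fn).
apply: tens_nbhs_mono H => y; first exact: ideal_exp_sub.
by move=> /(@ideal_exp_sub _ _ 1 N.+1 isT); rewrite ideal_exp1.
Qed.

Lemma tens_right_retract : exists F : {additive tensor A B -> B},
  [/\ forall b x, F (tens_right b * x) = b * F x, F 1 = 1 &
      forall N, exists N', forall x, ideal_exp (tensor_ideal m n) N' x ->
        ideal_exp n N (F x)].
Proof.
have [f [fl fm f1]] := exists_functional (ideal_subspace mI) m1.
have [F FE] := contract_right B fl; have [S SE] := tens_swap A B.
have FSE a b : F (S (tens a b)) = f a *: b by rewrite SE FE.
exists (F \o S : {additive _ -> _}); split.
- move=> b x; have := tens_spanT x; move: x.
  apply: tens_span_ind => [|x y Hx Hy|a' b' _];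
    first by rewrite mulr0 raddf0 mulr0.
    by rewrite mulrDr !raddfD Hx Hy mulrDr.
  by rewrite -tensM /= !FSE mul1r scalerAr.
- by rewrite -tens1 /= FSE f1 scale1r.
move=> N; exists (N.+1 + N.+1)%N => x /(exp_sub_adic_nbhs mI nI) H /=.
apply: (contract_nbhs FE (ideal_subspace (ideal_exp_ideal n N)) fm).
apply: tens_swap_nbhs => //; apply: tens_nbhs_mono H => y;
  last exact: ideal_exp_sub.
by move=> /(@ideal_exp_sub _ _ 1 N.+1 isT); rewrite ideal_exp1.
Qed.

Lemma completed_tensor_domain_factors : is_domain (completed_tensor m n) ->
  is_domain (completion m) /\ is_domain (completion n).
Proof.
have [F [FM F1 FI]] := tens_left_retract; have [G [GM G1 GI]] :=
  tens_right_retract.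
move=> dom; split.
  by apply: (completion_retract_domain FM F1 _ FI dom); exact: ideal_exp_tensl.
by apply: (completion_retract_domain GM G1 _ GI dom); exact: ideal_exp_tensr.
Qed.

Lemma completed_tensor_noetherian_factors : noetherian (completed_tensor m n) ->
  noetherian (completion m) /\ noetherian (completion n).
Proof.
have [F [FM F1 FI]] := tens_left_retract; have [G [GM G1 GI]] :=
  tens_right_retract.
move=> noeth; split.
  by apply: (completion_retract_noetherian FM F1 _ FI noeth);
    exact: ideal_exp_tensl.
by apply: (completion_retract_noetherian GM G1 _ GI noeth);
  exact: ideal_exp_tensr.
Qed.

Lemma completed_tensor_neq0 : (1 : completed_tensor m n) != 0.
Proof.
have [F [FM F1 FI]] := tens_left_retract.
apply/eqP => E; apply: m1; rewrite -F1 -(ideal_exp1 mI).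
have [N NP] := FI 1%N; apply: NP.
have cC := @adic_cauchy_cst _ (tensor_ideal m n) 1.
have : adic_null (tensor_ideal m n) (fun=> 1).
  by apply/(compl_class0P cC);
    rewrite -E -(rmorph1 (@compl_cst _ (tensor_ideal m n))).
by move=> /(_ N)[L /(_ L (leqnn _))].
Qed.

End TensorFactors.

(** The order of choices matters: contractions to [A] keep [f] and [g] nonzero and determine [phi];
    contractions to [B] are then taken relative to [phi], and determine [psi]. *)
Lemma completed_tensor_integral (k : closedFieldType) (A B : comAlgType k)
    (m : set A) (n : set B) :
  local_ring m -> local_ring n -> noetherian A -> noetherian B ->
  noetherian (completion m) -> noetherian (completion n) ->
  is_domain (completion m) -> is_domain (completion n) ->
  GRing.integral_domain_axiom (completed_tensor m n).
Proof.
move=> locA locB noethA noethB noethA' noethB' domA domB.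
have mI := local_ring_ideal locA; have nI := local_ring_ideal locB.
have toC f : adic_cauchy (tensor_ideal m n) f -> tens_cauchy m n f.
  move=> fC N; have [L LP] := fC (N + N)%N.
  by exists L => i j Li Lj; apply: exp_sub_adic_nbhs => //; exact: LP.
have neq0 (R : comPzRingType) (I : set R) u N : adic_cauchy I u ->
    (exists L, forall l, (L <= l)%N -> ~ ideal_exp I N (u l)) ->
      compl_class I u != 0.
  move=> uC [L LP]; apply/eqP => /(compl_class0P uC)/(_ N)[L' L'P].
  by apply: (LP (maxn L L')); [exact: leq_maxl|apply: L'P; exact: leq_maxr].
have first f : adic_cauchy (tensor_ideal m n) f ->
  compl_class (tensor_ideal m n) f != 0 ->
    exists N (lam : B -> k) (F : {additive tensor A B -> A}),
    [/\ forall a b, F (tens a b) = lam b *: a,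
      forall b, ideal_exp n N b -> lam b = 0,
      adic_cauchy m (fun l => F (f l)) & compl_class m (fun l => F (f l)) != 0].
  move=> fC f0.
  have [N fN] : exists N, forall L, exists2 l,
    (L <= l)%N & ~ adic_nbhs m n N (f l).
    apply: contrapT => H; move/eqP: f0; apply; apply/(compl_class0P fC) => N.
    apply: contrapT => nN; apply: H; exists N => L; apply: contrapT => nL.
    apply: nN; exists L => i Li; apply: contrapT => nf.
    by apply: nL; exists i => // /adic_nbhs_sub_exp.
  have [||||//|lam [F [FE lam0 FC Faway]]] :=
      @cauchy_contraction k A B m n f N (ideal_exp m N) (ideal_exp n N) (toC _
        fC).
  - exact/ideal_subspace/ideal_exp_ideal.
  - exact/ideal_subspace/ideal_exp_ideal.
  - by [].
  - by [].
  by exists N, lam, F; split=> //; exact: (neq0 _ _ _ N).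
move=> x y xy0; apply: contrapT => /negP; rewrite negb_or => /andP[].
move: xy0; have [f fC <-] := compl_class_surj x;
  have [g gC <-] := compl_class_surj y.
rewrite -compl_classM// => /(compl_class0P (adic_cauchyM fC gC)) fg0 f0 g0.
have [Nf [lf [Ff [FfE lf0 FfC Ff0]]]] := first _ fC f0.
have [Ng [lg [Fg [FgE lg0 FgC Fg0]]]] := first _ gC g0.
have mul0 (R : comPzRingType) (a b : R) : is_domain R -> a != 0 -> b != 0 ->
  a * b != 0.
  by move=> [_ dom] a0 b0; apply/eqP => /dom; rewrite (negbTE a0) (negbTE b0).
have [K [phi [phi0 phi1 phiN]]] :=
  exists_coheight_one_point noethA locA noethA' domA (mul0 _ _ _ domA Ff0 Fg0).
move: phi0; rewrite rmorphM mulf_eq0 negb_or => /andP[phif phig].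
pose kap : {rmorphism k -> K} := (base_restr phi \o in_alg A : {rmorphism k ->
  K}).
have [_ [c _ <-]|||M placeM tameM] := @exists_tame_place _ _ _ phi (range kap).
- by exists (compl_cst m c%:A).
- exact: phi1.
- exact: phiN.
have Vk c : stabilizer M (base_restr phi c%:A).
  by apply: (scalars_sub_stabilizer placeM); exists c.
have Vres z : stabilizer M z -> exists c, M (z - base_restr phi c%:A).
  exact: (@place_residue k K kap M z placeM).
(* The functional on [A] must kill some [kernel_nbhs phi i], so that it factors through the image of
   [A] under [phi]. Such a functional exists because the contraction of [h] to [A] survives under
   [phi]. *)
have second h N (lam : B -> k) (F : {additive tensor A B -> A}) :
    adic_cauchy (tensor_ideal m n) h ->
    (forall a b, F (tens a b) = lam b *: a) ->
    (forall b, ideal_exp n N b -> lam b = 0) ->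
    adic_cauchy m (fun l => F (h l)) -> phi (compl_class m (fun l =>
      F (h l))) != 0 ->
    exists i (mu : A -> k) (E : {additive tensor A B -> B}),
    [/\ forall a b, E (tens a b) = mu a *: b,
      forall a, kernel_nbhs phi i a -> mu a = 0,
      adic_cauchy n (fun l => E (h l)) & compl_class n (fun l => E (h l)) != 0].
  move=> hC FE lam0 FC F0.
  have [i [L LP]] := class_away placeM tameM FC F0.
  have sker := ideal_subspace (kernel_nbhs_ideal phi i).
  have [||||L'|mu [E [EE mu0 EC Eaway]]] :=
      @cauchy_contraction_left k A B m n h (maxn i N) (kernel_nbhs phi i)
        (ideal_exp n N) (toC _ hC).
  - exact: sker.
  - exact/ideal_subspace/ideal_exp_ideal.
  - by move=> a /(ideal_exp_kernel_nbhs phi); apply: kernel_nbhs_sub;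
    exact: leq_maxl.
  - by apply: ideal_exp_sub; exact: leq_maxr.
  - exists (maxn L L'); first exact: leq_maxr.
    move=> /(contract_nbhs FE sker lam0); apply: LP; exact: leq_maxl.
  by exists i, mu, E; split=> //; exact: (neq0 _ _ _ N).
have [i [mu [E [EE mu0 EC E0]]]] := second _ _ _ _ fC FfE lf0 FfC phif.
have [i' [mu' [E' [EE' mu0' EC' E0']]]] := second _ _ _ _ gC FgE lg0 FgC phig.
have [L [psi [psi0 psi1 psiN]]] :=
  exists_coheight_one_point noethB locB noethB' domB (mul0 _ _ _ domB E0 E0').
move: psi0; rewrite rmorphM mulf_eq0 negb_or => /andP[psif psig].
have [_ [c _ <-]|||N placeN tameN] := @exists_tame_place _ _ _ psi (range psi).
- by exists c.
- exact: psi1.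
- exact: psiN.
have WB b : stabilizer N (base_restr psi b).
  by apply: (scalars_sub_stabilizer placeN); exists (compl_cst n b).
have lead h j (lam : A -> k) (F : {additive tensor A B -> B}) :=
  @exists_leading_form k A B m n noethB K phi _ M placeM tameM Vk Vres L psi _ N
    placeN tameN WB h j lam F.
have ff := lead _ _ _ _ (toC _ fC) EE mu0 EC psif.
have gg := lead _ _ _ _ (toC _ gC) EE' mu0' EC' psig.
apply: (leading_form_mul placeM tameM Vk placeN tameN WB ff gg) => j.
have [l0 l0P] := fg0 (j + j)%N; exists l0 => l Ll.
by apply: exp_sub_adic_nbhs => //; exact: l0P.
Qed.

Theorem theorem5p8 (k : closedFieldType) (A B : comAlgType k)
    (m : set A) (n : set B) :
  local_ring m -> local_ring n ->
  noetherian A -> noetherian B ->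
  noetherian (completed_tensor m n) ->
  is_domain (completed_tensor m n) <->
  analytically_irreducible m /\ analytically_irreducible n.
Proof.
move=> locA locB noethA noethB noethT.
have mI := local_ring_ideal locA; have nI := local_ring_ideal locB.
have m1 := local_ring_proper locA; have n1 := local_ring_proper locB.
split=> [|[domA domB]]; first exact: completed_tensor_domain_factors.
have [noethA' noethB'] := completed_tensor_noetherian_factors mI nI m1 n1 noethT.
split; first exact: completed_tensor_neq0.
exact: completed_tensor_integral.
Qed.
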